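(* Let $(\mathcal H,\mathfrak m)$ and $(\mathcal H',\mathfrak m')$ be two $A_\infty$-algebras over $\mathbb C$ and let $\mathcal F:(\mathcal H,\mathfrak m)\to(\mathcal H',\mathfrak m')$ be an $A_\infty$-quasi-isomorphism. Then there exists an inverse $A_\infty$-quasi-isomorphism $\mathcal F^{-1}:(\mathcal H',\mathfrak m')\to(\mathcal H,\mathfrak m)$.
   Context: Vector spaces are $\mathbb Z$-graded over $\mathbb C$; exponents of $(-1)$ contain degrees. An $A_\infty$-algebra $(\mathcal H,\mathfrak m)$ is a graded vector space with degree $+1$ multilinear maps $m_k:\mathcal H^{\otimes k}\to\mathcal H$ $(k\ge1)$ such that for all $n\ge1$ $$\sum_{k+l=n+1}\sum_{j=0}^{k-1}(-1)^{o_1+\cdots+o_j}m_k(o_1,\dots,o_j,m_l(o_{j+1},\dots,o_{j+l}),o_{j+l+1},\dots,o_n)=0 ;$$ the lift $\mathfrak m$ of the $m_k$ to a coderivation of the tensor coalgebra $C(\mathcal H)=\oplus_{n\ge0}\mathcal H^{\otimes n}$ then satisfies $\mathfrak m^2=0$. An $A_\infty$-morphism $\mathcal F=\{f_k\}_{k\ge1}$ is a collection of degree $0$ maps $f_k:\mathcal H^{\otimes k}\to\mathcal H'$ whose induced coalgebra map $\mathcal F(o_1\cdots o_n)=\sum_{1\le k_1<\cdots<k_i=n} f_{k_1}(o_1,\dots,o_{k_1})\otimes\cdots\otimes f_{n-k_{i-1}}(o_{k_{i-1}+1},\dots,o_n)$ satisfies $\mathcal F\mathfrak m=\mathfrak m'\mathcal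 F$. It is an $A_\infty$-quasi-isomorphism if the chain map $f_1:(\mathcal H,m_1)\to(\mathcal H',m_1')$ induces an isomorphism on cohomology. An inverse $A_\infty$-quasi-isomorphism of $\mathcal F$ is an $A_\infty$-quasi-isomorphism in the opposite direction whose linear part induces on cohomology the inverse of the map induced by $f_1$. *)

(* Defs.v *)
From HB Require Import structures.
From mathcomp Require Import all_boot all_order all_algebra.
From mathcomp Require Import generic_quotient.
From mathcomp Require Import boolp reals.
From mathcomp Require Export complex.

Set Implicit Arguments.
Unset Strict Implicit.
Unset Printing Implicit Defensive.

Import GRing.Theory.

Local Open Scope ring_scope.
Local Open Scope quotient_scope.

(* A Z-graded vector space is a family [V : int -> lmodType K].  A [letter] is
   a homogeneous element together with its degree; a word [o_1, ..., o_n] of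
   letters stands for the elementary tensor o_1 (x) ... (x) o_n. *)
Definition letter (K : fieldType) (V : int -> lmodType K) : Type :=
  {d : int & V d}.

Definition homog (K : fieldType) (V : int -> lmodType K) (d : int) (x : V d) :
  letter V := Tagged (fun d => V d) x.

Definition wdeg (K : fieldType) (V : int -> lmodType K) (w : seq (letter V)) :
  int := \sum_(x <- w) tag x.

(* One map on words of arbitrary length, i.e. a whole family of multilinear
   maps indexed by the length of the word. *)
Definition multilinear (K : fieldType) (V : int -> lmodType K)
    (W : lmodType K) (phi : seq (letter V) -> W) : Prop :=
  forall (d : int) (s1 s2 : seq (letter V)) (a : K) (x y : V d),
    phi (s1 ++ homog (a *: x + y) :: s2) =
    a *: phi (s1 ++ homog x :: s2) + phi (s1 ++ homog y :: s2).

(* The underlying vector space of the tensor coalgebra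
   C(V) = \oplus_(n >= 0) V^{(x) n}: formal linear combinations of words, two
   of them being identified when no multilinear map separates them.  The
   lemmas [tens_multilinear], [tlift_tens] and [tlift_uniq] below are its
   universal property. *)
Section TensorCoalgebra.
Variables (K : fieldType) (V : int -> lmodType K).

Definition fsum : Type := seq (K * seq (letter V)).

Definition feval (W : lmodType K) (phi : seq (letter V) -> W) (x : fsum) : W :=
  \sum_(p <- x) p.1 *: phi p.2.

Definition fsum_eq : rel fsum := fun x y =>
  `[< forall (W : lmodType K) (phi : seq (letter V) -> W),
        multilinear phi -> feval phi x = feval phi y >].

Lemma fsum_eq_refl : reflexive fsum_eq.
Proof. by move=> x; apply/asboolP. Qed.

Lemma fsum_eq_sym : symmetric fsum_eq.
Proof.
by move=> x y; apply/asboolP/asboolP => h W phi hphi; rewrite (h W phi hphi).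
Qed.

Lemma fsum_eq_trans : transitive fsum_eq.
Proof.
move=> y x z /asboolP h1 /asboolP h2; apply/asboolP => W phi hphi.
by rewrite h1 // h2.
Qed.

Canonical fsum_equiv := EquivRel fsum_eq fsum_eq_refl fsum_eq_sym fsum_eq_trans.

Definition tcoalg : Type := {eq_quot fsum_equiv}.

HB.instance Definition _ := Choice.copy tcoalg {eq_quot fsum_equiv}.

Definition tclass (x : fsum) : tcoalg := \pi_({eq_quot fsum_equiv}) x.

Definition trepr (x : tcoalg) : fsum := repr (x : {eq_quot fsum_equiv}).

Lemma treprK x : tclass (trepr x) = x.
Proof. exact: reprK. Qed.

Lemma tclassP x y :
  (forall (W : lmodType K) (phi : seq (letter V) -> W),
     multilinear phi -> feval phi x = feval phi y) <-> tclass x = tclass y.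
Proof.
split=> [h|]; first by apply/(@eqmodP _ fsum_equiv)/asboolP.
by move/(@eqmodP _ fsum_equiv)/asboolP.
Qed.

Lemma feval_repr (W : lmodType K) (phi : seq (letter V) -> W) x :
  multilinear phi -> feval phi (trepr (tclass x)) = feval phi x.
Proof. by move: W phi; apply/tclassP; rewrite treprK. Qed.

Definition fscale (a : K) (x : fsum) : fsum := [seq (a * p.1, p.2) | p <- x].

Lemma feval_cat (W : lmodType K) (phi : seq (letter V) -> W) x y :
  feval phi (x ++ y) = feval phi x + feval phi y.
Proof. exact: big_cat. Qed.

Lemma feval_scale (W : lmodType K) (phi : seq (letter V) -> W) a x :
  feval phi (fscale a x) = a *: feval phi x.
Proof.
by rewrite /feval big_map scaler_sumr; apply: eq_bigr => p _; rewrite scalerA.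
Qed.

Lemma feval_nil (W : lmodType K) (phi : seq (letter V) -> W) :
  feval phi [::] = 0.
Proof. exact: big_nil. Qed.

Definition tadd (x y : tcoalg) : tcoalg := tclass (trepr x ++ trepr y).
Definition topp (x : tcoalg) : tcoalg := tclass (fscale (-1) (trepr x)).
Definition tscale (a : K) (x : tcoalg) : tcoalg := tclass (fscale a (trepr x)).
Definition tzero : tcoalg := tclass [::].

Let fevalE := (feval_cat, feval_scale, feval_nil).

Lemma taddA : associative tadd.
Proof.
move=> x y z; apply/tclassP => W phi h.
by rewrite !(fevalE, feval_repr) // addrA.
Qed.

Lemma taddC : commutative tadd.
Proof. by move=> x y; apply/tclassP => W phi h; rewrite !fevalE addrC. Qed.

Lemma tadd0 : left_id tzero tadd.
Proof.
move=> x; rewrite -[RHS]treprK; apply/tclassP => W phi h.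
by rewrite !(fevalE, feval_repr) // add0r.
Qed.

Lemma taddN : left_inverse tzero topp tadd.
Proof.
move=> x; apply/tclassP => W phi h.
by rewrite !(fevalE, feval_repr) // scaleN1r addNr.
Qed.

HB.instance Definition _ :=
  GRing.isZmodule.Build tcoalg taddA taddC tadd0 taddN.

Lemma tscaleA a b x : tscale a (tscale b x) = tscale (a * b) x.
Proof.
by apply/tclassP => W phi h; rewrite !(fevalE, feval_repr) // scalerA.
Qed.

Lemma tscale1 : left_id 1 tscale.
Proof.
move=> x; rewrite -[RHS]treprK; apply/tclassP => W phi h.
by rewrite !fevalE scale1r.
Qed.

Lemma tscaleDr : right_distributive tscale +%R.
Proof.
move=> a x y; apply/tclassP => W phi h.
by rewrite !(fevalE, feval_repr) // scalerDr.
Qed.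

Lemma tscaleDl x : {morph tscale^~ x : a b / a + b}.
Proof.
move=> a b; apply/tclassP => W phi h.
by rewrite !(fevalE, feval_repr) // scalerDl.
Qed.

HB.instance Definition _ :=
  GRing.Zmodule_isLmodule.Build K tcoalg tscaleA tscale1 tscaleDr tscaleDl.

Definition tens (w : seq (letter V)) : tcoalg := tclass [:: (1, w)].

Definition tlift (W : lmodType K) (phi : seq (letter V) -> W)
    (x : tcoalg) : W := feval phi (trepr x).

Lemma tens_multilinear : multilinear tens.
Proof.
move=> d s1 s2 a x y; apply/tclassP => W phi h.
rewrite feval_cat !(feval_repr, feval_scale) //.
by rewrite /feval !big_seq1 /= !scale1r h.
Qed.

Lemma tlift_linear (W : lmodType K) (phi : seq (letter V) -> W) :
  multilinear phi -> linear (tlift phi).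
Proof.
by move=> h a x y; rewrite /tlift !(feval_repr, fevalE).
Qed.

Lemma tlift_tens (W : lmodType K) (phi : seq (letter V) -> W) w :
  multilinear phi -> tlift phi (tens w) = phi w.
Proof. by move=> h; rewrite /tlift feval_repr // /feval big_seq1 scale1r. Qed.

Lemma tens_span x : x = \sum_(p <- trepr x) p.1 *: tens p.2.
Proof.
rewrite -[LHS]treprK; elim: (trepr x) => [|[a w] s IH].
  by rewrite big_nil.
rewrite big_cons -IH; apply/tclassP => W phi h.
by rewrite !(fevalE, feval_repr) // /feval big_cons big_seq1 scale1r.
Qed.

Lemma tlift_uniq (W : lmodType K) (g h : {linear tcoalg -> W}) :
  (forall w, g (tens w) = h (tens w)) -> g =1 h.
Proof.
move=> E x; rewrite (tens_span x) !linear_sum; apply: eq_bigr => p _.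
by rewrite !linearZ /= E.
Qed.

End TensorCoalgebra.

(* A family of degree [p] multilinear maps V^{(x) k} -> V', k >= 1, where k is
   the length of the word.  To avoid transport along equalities of degrees,
   [mm e w] is the component in V'_e of the value on [w]; it vanishes unless
   e = wdeg w + p.  There is no k = 0 map. *)
Record mmaps (K : fieldType) (V V' : int -> lmodType K) (p : int) := MMaps {
  mm :> forall e : int, seq (letter V) -> V' e;
  mm_lin : forall e, multilinear (mm e);
  mm_deg : forall e w, e != wdeg w + p -> mm e w = 0;
  mm_nil : forall e, mm e [::] = 0
}.

Definition mm_app (K : fieldType) (V V' : int -> lmodType K) (p : int)
    (f : mmaps V V' p) (w : seq (letter V)) : letter V' :=
  homog (f (wdeg w + p) w).

Section Lifts.
Variables (K : fieldType) (V V' : int -> lmodType K).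

(* o_1, ..., o_j, m_l (o_{j+1}, ..., o_{j+l}), o_{j+l+1}, ..., o_n *)
Definition insert (m : mmaps V V 1) (j l : nat) (w : seq (letter V)) :
  seq (letter V) := take j w ++ mm_app m (take l (drop j w)) :: drop (j + l) w.

Definition koszul (j : nat) (w : seq (letter V)) : K := (-1) ^ wdeg (take j w).

(* In the sums below l = n + 1 - k, where n = size w. *)
Definition ainf_relation (m : mmaps V V 1) : Prop :=
  forall (w : seq (letter V)) (e : int), (0 < size w)%N ->
    \sum_(1 <= k < (size w).+1) \sum_(0 <= j < k)
      koszul j w *: m e (insert m j ((size w).+1 - k) w) = 0.

Definition coder_word (m : mmaps V V 1) (w : seq (letter V)) : tcoalg V :=
  \sum_(1 <= k < (size w).+1) \sum_(0 <= j < k)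
    koszul j w *: tens (insert m j ((size w).+1 - k) w).

Definition coder (m : mmaps V V 1) : tcoalg V -> tcoalg V :=
  tlift (coder_word m).

Definition composition (n i : nat) (c : i.-tuple 'I_n.+1) : bool :=
  (0%N \notin [seq val b | b <- c]) && (sumn [seq val b | b <- c] == n).

Definition fblocks (f : mmaps V V' 0) (c : seq nat) (w : seq (letter V)) :
  seq (letter V') := [seq mm_app f b | b <- reshape c w].

(* The successive block lengths c stand for the cut points
   1 <= k_1 < ... < k_i = n; the empty word is mapped to the empty word. *)
Definition coalg_word (f : mmaps V V' 0) (w : seq (letter V)) : tcoalg V' :=
  \sum_(i < (size w).+1)
    \sum_(c : i.-tuple 'I_(size w).+1 | composition c)
      tens (fblocks f [seq val b | b <- c] w).

Definition coalg_map (f : mmaps V V' 0) : tcoalg V -> tcoalg V' :=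
  tlift (coalg_word f).

End Lifts.

Section LiftTheory.
Variables (K : fieldType) (V V' : int -> lmodType K).

Lemma wdeg_cat (s t : seq (letter V)) : wdeg (s ++ t) = wdeg s + wdeg t.
Proof. exact: big_cat. Qed.

Lemma wdeg_slot (s1 s2 : seq (letter V)) d (x y : V d) :
  wdeg (s1 ++ homog x :: s2) = wdeg (s1 ++ homog y :: s2).
Proof. by rewrite !wdeg_cat /wdeg !big_cons. Qed.

Lemma multilinear_sum (W : lmodType K) (I : Type) (r : seq I) (P : pred I)
    (phi : I -> seq (letter V) -> W) :
  (forall i, P i -> multilinear (phi i)) ->
  multilinear (fun w => \sum_(i <- r | P i) phi i w).
Proof.
move=> h d s1 s2 a x y; rewrite scaler_sumr -big_split /=.
by apply: eq_bigr => i Pi; rewrite h.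
Qed.

(* The multilinearity of [mm_app], in context. *)
Lemma mm_app_slot (W : lmodType K) (phi : seq (letter V') -> W) p
    (f : mmaps V V' p) (t1 t2 : seq (letter V')) d s1 s2 a (x y : V d) :
  multilinear phi ->
  phi (t1 ++ mm_app f (s1 ++ homog (a *: x + y) :: s2) :: t2) =
  a *: phi (t1 ++ mm_app f (s1 ++ homog x :: s2) :: t2) +
  phi (t1 ++ mm_app f (s1 ++ homog y :: s2) :: t2).
Proof.
move=> h; rewrite /mm_app (wdeg_slot s1 s2 (a *: x + y) x).
by rewrite (wdeg_slot s1 s2 y x) mm_lin h.
Qed.

End LiftTheory.

Section LiftLinear.
Variables (K : fieldType) (V V' : int -> lmodType K).

Lemma take_slot j (s1 s2 : seq (letter V)) z : (size s1 < j)%N ->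
  take j (s1 ++ z :: s2) = s1 ++ z :: take (j - (size s1).+1) s2.
Proof.
move=> lt; rewrite take_cat ltnNge (ltnW lt) /=.
by rewrite -[in LHS](subnSK lt).
Qed.

Lemma drop_slot j (s1 s2 : seq (letter V)) z : (j <= size s1)%N ->
  drop j (s1 ++ z :: s2) = drop j s1 ++ z :: s2.
Proof.
rewrite drop_cat leq_eqVlt => /orP[/eqP ->|->] //.
by rewrite ltnn subnn drop0 drop_size.
Qed.

Lemma take_pre j (s1 s2 : seq (letter V)) : (j <= size s1)%N ->
  take j (s1 ++ s2) = take j s1.
Proof. by move=> le; rewrite takel_cat. Qed.

Lemma drop_post j (s1 s2 : seq (letter V)) z : (size s1 < j)%N ->
  drop j (s1 ++ z :: s2) = drop (j - (size s1).+1) s2.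
Proof.
move=> lt; rewrite drop_cat ltnNge (ltnW lt) /=.
by rewrite -[in LHS](subnSK lt).
Qed.

Lemma insert_multilinear (W : lmodType K) (phi : seq (letter V) -> W)
    (m : mmaps V V 1) j l :
  multilinear phi -> multilinear (fun w => koszul j w *: phi (insert m j l w)).
Proof.
move=> h d s1 s2 a x y.
have hk (z : V d) :
    koszul j (s1 ++ homog z :: s2) = koszul j (s1 ++ homog x :: s2).
  rewrite /koszul; congr (_ ^ _); case: (ltnP (size s1) j) => lt.
    by rewrite !take_slot //; exact: wdeg_slot.
  by rewrite !take_pre.
rewrite (hk (a *: x + y)) (hk y) scalerA [a * _]mulrC -scalerA -scalerDr.
congr (_ *: _); rewrite /insert.
case: (ltnP (size s1) j) => lt.
  have lt' : (size s1 < j + l)%N by rewrite ltn_addr.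
  rewrite !(take_slot _ _ lt) !(drop_post _ _ lt).
  by rewrite !(drop_post _ _ lt') -!catA /= h.
rewrite !(take_pre _ lt) !(drop_slot _ _ lt).
case: (ltnP (size (drop j s1)) l) => lt2.
  have lt3 : (size s1 < j + l)%N by rewrite size_drop ltn_subLR in lt2.
  rewrite !(take_slot _ _ lt2) !(drop_post _ _ lt3).
  exact: (mm_app_slot _ _ _ _ _ _ _ _ h).
have le3 : (j + l <= size s1)%N.
  by move: lt2; rewrite size_drop -(leq_add2l j) subnKC.
rewrite !(take_pre _ lt2) !(drop_slot _ _ le3).
by have := h d (take j s1 ++ mm_app m (take l (drop j s1)) :: drop (j + l) s1)
  s2 a x y; rewrite -!catA.
Qed.

Lemma size_slot (s1 s2 : seq (letter V)) (z z' : letter V) :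
  size (s1 ++ z :: s2) = size (s1 ++ z' :: s2).
Proof. by rewrite !size_cat. Qed.

Lemma coder_word_multilinear (m : mmaps V V 1) : multilinear (coder_word m).
Proof.
move=> d s1 s2 a x y; rewrite /coder_word.
rewrite (size_slot _ _ (homog (a *: x + y)) (homog x)).
rewrite (size_slot _ _ (homog y) (homog x)).
set n := size _.
suff h : multilinear (fun w => \sum_(1 <= k < n.+1) \sum_(0 <= j < k)
    koszul j w *: tens (insert m j (n.+1 - k) w)) by exact: h.
apply: multilinear_sum => k _; apply: multilinear_sum => j _.
exact/insert_multilinear/tens_multilinear.
Qed.

Lemma fblocks_slot (W : lmodType K) (phi : seq (letter V') -> W)
    (f : mmaps V V' 0) (t : seq (letter V')) c d s1 s2 a (x y : V d) :
  (size s1 < sumn c)%N -> multilinear phi ->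
  phi (t ++ fblocks f c (s1 ++ homog (a *: x + y) :: s2)) =
  a *: phi (t ++ fblocks f c (s1 ++ homog x :: s2)) +
  phi (t ++ fblocks f c (s1 ++ homog y :: s2)).
Proof.
move=> + h; elim: c t s1 => [|b c IH] t s1 //= lt; rewrite /fblocks /=.
case: (ltnP (size s1) b) => ltb.
  rewrite !(take_slot _ _ ltb) !(drop_post _ _ ltb).
  exact: (mm_app_slot _ _ _ _ _ _ _ _ h).
rewrite !(take_pre _ ltb) !(drop_slot _ _ ltb) -!(cat_rcons (mm_app _ _)).
apply: (IH (rcons t _) (drop b s1)).
by rewrite size_drop ltn_subLR.
Qed.

Lemma coalg_word_multilinear (f : mmaps V V' 0) : multilinear (coalg_word f).
Proof.
move=> d s1 s2 a x y; rewrite /coalg_word.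
rewrite (size_slot _ _ (homog (a *: x + y)) (homog x)).
rewrite (size_slot _ _ (homog y) (homog x)).
set n := size _; rewrite scaler_sumr -big_split; apply: eq_bigr => i _ /=.
rewrite scaler_sumr -big_split; apply: eq_bigr => c /andP[_ /eqP sc] /=.
apply: (@fblocks_slot _ (@tens _ _) f [::]); last exact: tens_multilinear.
by rewrite sc /n size_cat /= addnS ltnS leq_addr.
Qed.

HB.instance Definition _ (m : mmaps V V 1) :=
  GRing.isLinear.Build K (tcoalg V) (tcoalg V) *:%R (coder m)
    (tlift_linear (coder_word_multilinear m)).

HB.instance Definition _ (f : mmaps V V' 0) :=
  GRing.isLinear.Build K (tcoalg V) (tcoalg V') *:%R (coalg_map f)
    (tlift_linear (coalg_word_multilinear f)).

Lemma coder_tens (m : mmaps V V 1) w : coder m (tens w) = coder_word m w.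
Proof. exact/tlift_tens/coder_word_multilinear. Qed.

Lemma coalg_map_tens (f : mmaps V V' 0) w :
  coalg_map f (tens w) = coalg_word f w.
Proof. exact/tlift_tens/coalg_word_multilinear. Qed.

End LiftLinear.

Record ainf_algebra (K : fieldType) := AinfAlgebra {
  ainf_space :> int -> lmodType K;
  ainf_ops : mmaps ainf_space ainf_space 1;
  ainf_opsP : ainf_relation ainf_ops
}.

Record ainf_morphism (K : fieldType) (A B : ainf_algebra K) := AinfMorphism {
  ainf_maps :> mmaps A B 0;
  ainf_mapsP : forall x : tcoalg A,
    coalg_map ainf_maps (coder (ainf_ops A) x) =
    coder (ainf_ops B) (coalg_map ainf_maps x)
}.

Section LinearPart.
Variable K : fieldType.
Implicit Types V : int -> lmodType K.

Lemma mm_letterD V V' p (f : mmaps V V' p) e k a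
    (x y : V k) :
  f e [:: homog (a *: x + y)] = a *: f e [:: homog x] + f e [:: homog y].
Proof. exact: (@mm_lin _ _ _ _ f e k [::] [::]). Qed.

Lemma mm_letter0 V V' p (f : mmaps V V' p) e k :
  f e [:: homog (0 : V k)] = 0.
Proof.
have := mm_letterD f e (-1) (0 : V k) 0.
by rewrite scaler0 addr0 scaleN1r addNr.
Qed.

Lemma mm_letterB V V' p (f : mmaps V V' p) e k (x y : V k) :
  f e [:: homog (x - y)] = f e [:: homog x] - f e [:: homog y].
Proof. by rewrite addrC -scaleN1r mm_letterD scaleN1r addrC. Qed.

Lemma wdeg1 V d (x : V d) : wdeg [:: homog x] = d.
Proof. exact: big_seq1. Qed.

Lemma mm_app_homog V V' p (f : mmaps V V' p) w e :
  wdeg w + p = e -> mm_app f w = homog (f e w).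
Proof. by move=> <-. Qed.

Lemma coder_word1 V (m : mmaps V V 1) (o : letter V) :
  coder_word m [:: o] = tens [:: mm_app m [:: o]].
Proof.
by rewrite /coder_word /= !big_nat1 /koszul /wdeg big_nil expr0z scale1r.
Qed.

Lemma coalg_word1 V V' (f : mmaps V V' 0) (o : letter V) :
  coalg_word f [:: o] = tens [:: mm_app f [:: o]].
Proof.
rewrite /coalg_word /= big_ord_recl big_pred0 ?add0r; last first.
  by move=> c; rewrite tuple0.
rewrite big_ord1 (big_pred1 [tuple (ord_max : 'I_2)]) // => c.
rewrite /composition; case/tupleP: c => b c; rewrite tuple0 /=.
by case: b => [[|[|]]].
Qed.

(* The component in degree [e] of a letter. *)
Definition lcomp V (e : int) (o : letter V) : V e :=
  if tag o =P e is ReflectT E then eq_rect (tag o) V (tagged o) e E else 0.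

Lemma lcomp_homog V e (x : V e) : lcomp e (homog x) = x.
Proof. by rewrite /lcomp; case: eqP => //= E; rewrite eq_axiomK. Qed.

Lemma lcomp_linear V e d a (x y : V d) :
  lcomp e (homog (a *: x + y)) = a *: lcomp e (homog x) + lcomp e (homog y).
Proof.
rewrite /lcomp /=; case: eqP => [E|_]; last by rewrite scaler0 addr0.
by case: _ / E.
Qed.

Definition wcomp V (e : int) (w : seq (letter V)) : V e :=
  if w is [:: o] then lcomp e o else 0.

Lemma wcomp_multilinear V e : multilinear (@wcomp V e).
Proof.
move=> d [|o [|o' s1]] [|o2 s2] a x y /=; rewrite ?scaler0 ?addr0 //.
exact: lcomp_linear.
Qed.

Lemma morphism1 (A B : ainf_algebra K) (F : ainf_morphism A B) d e (x : A d) :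
  e = d + 1 ->
  F e [:: homog (ainf_ops A e [:: homog x])] =
  ainf_ops B e [:: homog (F d [:: homog x])].
Proof.
move=> De; have := ainf_mapsP F (tens [:: homog x]).
rewrite coder_tens coalg_map_tens coder_word1 coalg_word1.
rewrite (@mm_app_homog _ _ _ _ _ e) ?wdeg1 //.
rewrite (@mm_app_homog _ _ _ _ _ d) ?wdeg1 ?addr0 //.
rewrite coder_tens coalg_map_tens coder_word1 coalg_word1.
rewrite (@mm_app_homog _ _ _ _ _ e) ?wdeg1 ?addr0 //.
rewrite (@mm_app_homog _ _ _ _ _ e) ?wdeg1 //.
move/(congr1 (tlift (wcomp e))).
by rewrite !tlift_tens /= ?lcomp_homog //; exact: wcomp_multilinear.
Qed.

End LinearPart.

Section Cohomology.
Variables (K : fieldType) (A : ainf_algebra K) (d : int).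

Definition is_cocycle (x : A d) : bool :=
  ainf_ops A (d + 1) [:: homog x] == 0.

Definition cocycle : Type := {x : A d | is_cocycle x}.

HB.instance Definition _ := Choice.copy cocycle {x : A d | is_cocycle x}.

(* In [ainf_ops A d [:: homog z]] with z in degree d - 1, the component index d
   plays the role of (d - 1) + 1. *)
Definition cohomologous : rel cocycle := fun x y =>
  `[< exists z : A (d - 1), val x - val y = ainf_ops A d [:: homog z] >].

Lemma cohomologous_refl : reflexive cohomologous.
Proof. by move=> x; apply/asboolP; exists 0; rewrite subrr mm_letter0. Qed.

Lemma cohomologous_sym : symmetric cohomologous.
Proof.
suff h x y : cohomologous x y -> cohomologous y x.
  by move=> x y; apply/idP/idP; exact: h.
move=> /asboolP[z hz]; apply/asboolP; exists (0 - z).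
by rewrite mm_letterB mm_letter0 sub0r -hz opprB.
Qed.

Lemma cohomologous_trans : transitive cohomologous.
Proof.
move=> y x z /asboolP[u hu] /asboolP[v hv]; apply/asboolP.
exists (1 *: u + v); rewrite mm_letterD scale1r -hu -hv.
by rewrite addrA subrK.
Qed.

Canonical cohomologous_equiv :=
  EquivRel cohomologous cohomologous_refl cohomologous_sym cohomologous_trans.

Definition cohomology : Type := {eq_quot cohomologous_equiv}.

Definition coh_class (x : cocycle) : cohomology :=
  \pi_({eq_quot cohomologous_equiv}) x.

Definition coh_repr (c : cohomology) : cocycle :=
  repr (c : {eq_quot cohomologous_equiv}).

End Cohomology.

Section InducedMap.
Variables (K : fieldType) (A B : ainf_algebra K) (F : ainf_morphism A B).
Variable d : int.

Lemma is_cocycle_map (x : A d) :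
  is_cocycle x -> is_cocycle (F d [:: homog x]).
Proof.
by move=> /eqP hx; rewrite /is_cocycle -morphism1 // hx mm_letter0.
Qed.

Definition cocycle_map (x : cocycle A d) : cocycle B d :=
  exist _ (F d [:: homog (val x)]) (is_cocycle_map (valP x)).

Definition coh_map (c : cohomology A d) : cohomology B d :=
  coh_class (cocycle_map (coh_repr c)).

Lemma coh_mapE x : coh_map (coh_class x) = coh_class (cocycle_map x).
Proof.
apply/(@eqmodP _ (cohomologous_equiv B d))/asboolP.
have /(@eqmodP _ (cohomologous_equiv A d))/asboolP[z hz] :
    coh_class (coh_repr (coh_class x)) = coh_class x by exact: reprK.
exists (F (d - 1) [:: homog z]); rewrite -morphism1 ?subrK // -hz /=.
by rewrite mm_letterB.
Qed.

End InducedMap.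

(* [coh_map] is induced by a linear map, so bijectivity is all that is needed
   for an isomorphism of graded vector spaces. *)
Definition quasi_isomorphism (K : fieldType) (A B : ainf_algebra K)
    (F : ainf_morphism A B) : Prop :=
  forall d : int, bijective (coh_map F (d := d)).

Definition inverse_quasi_isomorphism (K : fieldType) (A B : ainf_algebra K)
    (F : ainf_morphism A B) (G : ainf_morphism B A) : Prop :=
  quasi_isomorphism G /\
  forall d : int, cancel (coh_map F (d := d)) (coh_map G (d := d)) /\
                  cancel (coh_map G (d := d)) (coh_map F (d := d)).

(* Main.v *)
Require Import Defs.
From mathcomp Require Import all_boot all_order all_algebra reals complex.
From mathcomp Require Import boolp classical_sets.
From mathcomp Require Import zify ring.

Set Implicit Arguments.
Unset Strict Implicit.
Unset Printing Implicit Defensive.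

Import GRing.Theory.
Local Open Scope ring_scope.

(** An inverse of [F] is found together with a homotopy.  The pairs (G, H) of a
    morphism G from B to A and a homotopy H from F G to the identity of B are
    the A-infinity morphisms from B that lift the identity of B along a strict
    projection D -> B, where D is the A-infinity algebra [path_algebra] on
    A + B + B[-1].  On the first two summands the operations of D are those of
    A and B; the third one carries the homotopy formula
      f_n(a_1, .., a_n) - b + sum of +- m(F(a_1, .., a_i), s, b_{i+2}, .., b_n).
    The relations of D ([path_relation]) reduce to F m = m F and m m = 0, after
    the terms coming from f_n and from -b have telescoped ([path_pull]).

    The kernel of D -> B is the mapping cone of f_1, which is acyclic since F is
    a quasi-isomorphism ([cone_acyclic]).  Over a field it therefore has a
    contraction eta, m_1 eta + eta m_1 = 1, which can be chosen with eta eta = 0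
    ([acyclic_contraction]); the complements of subspaces come from Zorn's
    lemma.  Let sigma be the graded inclusion of B in D, which is not a chain
    map.  A section S of D -> B ([strict_fibration_section]) is the solution of
      s = sigma - eta (m_1 sigma + m_2 (S) + m_3 (S) + ...),
    an equation that gives the value of s on a word from its values on shorter
    words.  Its defect E = m S - S m vanishes ([section_defect]): E takes values
    in the kernel and eta E = 0, so E = eta m_1 E; and if E vanishes on the
    shorter words, then m m = 0 on both sides gives m_1 E = - E m, which eta
    kills.

    The A-component of S is a morphism G, and the B[-1]-component h of its
    linear part satisfies f g - 1 = m h + h m.  So f_1 g_1 is the identity on
    cohomology, and g_1 inverts f_1 there because f_1 is bijective.

    Identities between coderivations and coalgebra maps are stated for functions
    phi on words: [coder_pull m phi] and [coalg_pull f phi] are the compositions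
    of phi with the coderivation of m and with the coalgebra map of f.  In this
    language the A-infinity relation reads [coder_pull m m = 0] and the morphism
    equation reads [coalg_pull f m' = coder_pull m f]; both pullbacks are
    computed by recursion on the first letter or block of the word. *)

(** * Sums over the cuts of a word, and multilinear functions *)

Section CutSum.
Variable T : Type.

(** The deconcatenation coproduct of [w] paired with [G]: both the empty prefix
    and the empty suffix count. *)
Fixpoint cutsum (W : zmodType) (G : seq T -> seq T -> W) (w : seq T) : W :=
  match w with
  | [::] => G [::] [::]
  | a :: w' => G [::] w + cutsum (fun x z => G (a :: x) z) w'
  end.

Lemma cutsum_ext (W : zmodType) (G H : seq T -> seq T -> W) w :
  (forall x z, x ++ z = w -> G x z = H x z) -> cutsum G w = cutsum H w.
Proof.
elim: w G H => [|a w IH] G H E /=; first by rewrite E.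
by rewrite E //; congr (_ + _); apply: IH => x z Ew; rewrite E //= Ew.
Qed.

Lemma cutsumD (W : zmodType) (G H : seq T -> seq T -> W) w :
  cutsum (fun x z => G x z + H x z) w = cutsum G w + cutsum H w.
Proof. by elim: w G H => //= a w IH G H; rewrite IH addrACA. Qed.

Lemma cutsumN (W : zmodType) (G : seq T -> seq T -> W) w :
  cutsum (fun x z => - G x z) w = - cutsum G w.
Proof. by elim: w G => //= a w IH G; rewrite IH opprD. Qed.

Lemma cutsum0 (W : zmodType) w : cutsum (fun _ _ => 0 : W) w = 0.
Proof. by elim: w => //= a w ->; rewrite addr0. Qed.

Lemma cutsum_lin (K : fieldType) (U W : lmodType K) (L : U -> W) G w :
  linear L -> L (cutsum G w) = cutsum (fun x z => L (G x z)) w.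
Proof.
move=> hL; elim: w G => [|a w IH] G //=.
by rewrite -[G _ _]scale1r hL !scale1r IH.
Qed.

Lemma cutsumZ (K : fieldType) (W : lmodType K) (a : K) G w :
  cutsum (fun x z => a *: G x z : W) w = a *: cutsum G w.
Proof. by elim: w G => //= b w IH G; rewrite IH scalerDr. Qed.

(** Coassociativity of deconcatenation: either way this is the sum over the
    decompositions w = x ++ y ++ z. *)
Lemma cutsum_assoc (W : zmodType) (G : seq T -> seq T -> seq T -> W) w :
  cutsum (fun u z => cutsum (fun x y => G x y z) u) w =
  cutsum (fun x v => cutsum (fun y z => G x y z) v) w.
Proof.
elim: w G => //= a w IH G.
by rewrite cutsumD addrA IH.
Qed.

(** Splits off the cut at the end of the word, the one that survives when
    longer outputs are killed. *)
Lemma cutsum_rcut (W : zmodType) (G : seq T -> seq T -> W) w :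
  cutsum G w =
  cutsum (fun x z => if z is _ :: _ then G x z else 0) w + G w [::].
Proof. by elim: w G => [|a w IH] G /=; rewrite ?add0r // IH addrA. Qed.

Lemma cutsum_takedrop (W : zmodType) (G : seq T -> seq T -> W) w :
  cutsum G w = \sum_(0 <= i < (size w).+1) G (take i w) (drop i w).
Proof.
elim: w G => [|a w IH] G /=; first by rewrite big_nat1.
by rewrite big_nat_recl //= IH.
Qed.

End CutSum.

Lemma cutsum_map S T (W : zmodType) (G : seq T -> seq T -> W) (h : S -> T) w :
  cutsum G (map h w) = cutsum (fun x z => G (map h x) (map h z)) w.
Proof. by elim: w G => //= a w IH G; rewrite IH. Qed.

Section Multilinear.
Variables (K : fieldType) (V : int -> lmodType K).

Lemma multilinear_cat (W : lmodType K) (phi : seq (letter V) -> W) u v :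
  multilinear phi -> multilinear (fun x => phi (u ++ x ++ v)).
Proof.
move=> h d s1 s2 a x y.
by have := h d (u ++ s1) (s2 ++ v) a x y; rewrite -!catA.
Qed.

Lemma multilinear_cons (W : lmodType K) (phi : seq (letter V) -> W) a :
  multilinear phi -> multilinear (fun x => phi (a :: x)).
Proof. by move=> h d s1 s2 c x y; apply: (h d (a :: s1)). Qed.

Lemma linear_slot (W : lmodType K) (phi : seq (letter V) -> W) s1 s2 d :
  multilinear phi -> linear (fun x : V d => phi (s1 ++ homog x :: s2)).
Proof. by move=> h a x y; rewrite h. Qed.

Lemma linear_slot1 (W : lmodType K) (phi : seq (letter V) -> W) s2 d :
  multilinear phi -> linear (fun x : V d => phi (homog x :: s2)).
Proof. exact: (@linear_slot _ _ [::]). Qed.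

(* Linearity is kept as a predicate: the maps are abstractions over one slot of
   a word, for which no linear structure is inferred. *)
Lemma lin0 (U W : lmodType K) (L : U -> W) : linear L -> L 0 = 0.
Proof.
move=> hL; have := hL 0 0 0; rewrite !scale0r !add0r => E.
have := hL (-1) 0 0; rewrite scaler0 addr0 E => {1}->.
by rewrite scaleN1r addNr.
Qed.

Lemma linD (U W : lmodType K) (L : U -> W) x y :
  linear L -> L (x + y) = L x + L y.
Proof. by move=> hL; have := hL 1 x y; rewrite !scale1r. Qed.

Lemma linZ (U W : lmodType K) (L : U -> W) a x :
  linear L -> L (a *: x) = a *: L x.
Proof. by move=> hL; have := hL a x 0; rewrite !addr0 (lin0 hL) addr0. Qed.

Lemma linN (U W : lmodType K) (L : U -> W) x : linear L -> L (- x) = - L x.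
Proof. by move=> hL; rewrite -scaleN1r linZ // scaleN1r. Qed.

Lemma linB (U W : lmodType K) (L : U -> W) x y :
  linear L -> L (x - y) = L x - L y.
Proof. by move=> hL; rewrite linD // linN. Qed.

Lemma lin_sum (U W : lmodType K) (L : U -> W) I (r : seq I) (P : pred I) G :
  linear L -> L (\sum_(i <- r | P i) G i) = \sum_(i <- r | P i) L (G i).
Proof.
move=> hL; elim/big_rec2: _ => [|i x y _ <-]; first exact: lin0.
exact: linD.
Qed.

Lemma multilinear_comp (U W : lmodType K) (L : U -> W)
    (phi : seq (letter V) -> U) :
  linear L -> multilinear phi -> multilinear (fun w => L (phi w)).
Proof. by move=> hL h d s1 s2 a x y; rewrite h hL. Qed.

Lemma multilinearD (W : lmodType K) (phi psi : seq (letter V) -> W) :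
  multilinear phi -> multilinear psi -> multilinear (fun w => phi w + psi w).
Proof.
by move=> h1 h2 d s1 s2 a x y; rewrite h1 h2 scalerDr addrACA.
Qed.

Lemma multilinearN (W : lmodType K) (phi : seq (letter V) -> W) :
  multilinear phi -> multilinear (fun w => - phi w).
Proof. by move=> h d s1 s2 a x y; rewrite h opprD scalerN. Qed.

Lemma multilinear0 (W : lmodType K) :
  multilinear (fun _ : seq (letter V) => 0 : W).
Proof. by move=> d s1 s2 a x y; rewrite scaler0 addr0. Qed.

Lemma multilinear_zero (W : lmodType K) (phi : seq (letter V) -> W) s1 s2 d :
  multilinear phi -> phi (s1 ++ homog (0 : V d) :: s2) = 0.
Proof. by move=> h; have := lin0 (@linear_slot W phi s1 s2 d h). Qed.

Lemma multilinear_cutsum (W : lmodType K)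
    (G : seq (letter V) -> seq (letter V) -> W) :
  (forall z, multilinear (G^~ z)) -> (forall x, multilinear (G x)) ->
  multilinear (cutsum G).
Proof.
move=> h1 h2 d s1; elim: s1 G h1 h2 => [|b s1 IH] G h1 h2 s2 a x y /=.
  rewrite (h2 [::] d [::]) scalerDr addrACA; congr (_ + _).
  rewrite -cutsumZ -cutsumD; apply: cutsum_ext => u z _.
  exact: (h1 z d [::]).
have /= -> := h2 [::] d (b :: s1) s2 a x y.
rewrite scalerDr addrACA; congr (_ + _).
apply: IH => [z|u]; last exact: h2.
by move=> d' t1 t2; apply: (h1 z d' (b :: t1)).
Qed.

(** The Koszul sign of a degree one operator that passes over [w]. *)
Definition wsign (w : seq (letter V)) : K := (-1) ^ wdeg w.

Lemma wdeg_nil : wdeg ([::] : seq (letter V)) = 0.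
Proof. exact: big_nil. Qed.

Lemma wdeg_cons (a : letter V) w : wdeg (a :: w) = tag a + wdeg w.
Proof. exact: big_cons. Qed.

Lemma signD (m n : int) : (-1 : K) ^ (m + n) = (-1) ^ m * (-1) ^ n.
Proof. by rewrite expfzDr // oppr_eq0 oner_eq0. Qed.

Lemma wsign_nil : wsign [::] = 1.
Proof. by rewrite /wsign wdeg_nil expr0z. Qed.

Lemma wsign_cons a w : wsign (a :: w) = (-1) ^ tag a * wsign w.
Proof. by rewrite /wsign wdeg_cons signD. Qed.

Lemma sign_sqr (m : int) : (-1 : K) ^ m * (-1) ^ m = 1.
Proof. by rewrite -expfzMl mulN1r opprK exp1rz. Qed.

Lemma wsign_sqr w : wsign w * wsign w = 1.
Proof. exact: sign_sqr. Qed.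

Lemma multilinear_wsign (W : lmodType K) (phi : seq (letter V) -> W) :
  multilinear phi -> multilinear (fun w => wsign w *: phi w).
Proof.
move=> h d s1 s2 a x y; rewrite /wsign (wdeg_slot s1 s2 y x).
rewrite (wdeg_slot s1 s2 (a *: x + y) x) h scalerDr !scalerA.
by rewrite [_ * a]mulrC.
Qed.

End Multilinear.

(** * Pullback along a coderivation *)

Lemma tag_mm_app (K : fieldType) (V V' : int -> lmodType K) p
    (f : mmaps V V' p) w :
  tag (mm_app f w) = wdeg w + p.
Proof. by []. Qed.

Lemma mm_app_nil (K : fieldType) (V V' : int -> lmodType K) (W : lmodType K)
    (phi : seq (letter V') -> W) s1 s2 p (f : mmaps V V' p) :
  multilinear phi -> phi (s1 ++ mm_app f [::] :: s2) = 0.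
Proof. by move=> h; rewrite /mm_app mm_nil; exact: multilinear_zero. Qed.

Section CoderivationPullback.
Variables (K : fieldType) (V : int -> lmodType K).
Implicit Types (m : mmaps V V 1) (w : seq (letter V)).

(** The function [phi] composed with the coderivation of [m].  The sum runs
    over the blocks that start at the first letter; the other blocks leave that
    letter in place. *)
Fixpoint coder_pull m (W : lmodType K) (phi : seq (letter V) -> W) w : W :=
  match w with
  | [::] => 0
  | a :: w' => cutsum (fun y z => phi (mm_app m (a :: y) :: z)) w' +
               (-1) ^ tag a *: coder_pull m (fun u => phi (a :: u)) w'
  end.

Section Fixm.
Variable m : mmaps V V 1.

Lemma coder_pull_cons (W : lmodType K) (phi : seq (letter V) -> W) a w :
  coder_pull m phi (a :: w) =
  cutsum (fun y z => phi (mm_app m (a :: y) :: z)) w +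
  (-1) ^ tag a *: coder_pull m (fun u => phi (a :: u)) w.
Proof. by []. Qed.

Lemma coder_pull_ext (W : lmodType K) (phi psi : seq (letter V) -> W) w :
  (forall u, wdeg u = wdeg w + 1 -> phi u = psi u) ->
  coder_pull m phi w = coder_pull m psi w.
Proof.
elim: w phi psi => //= a w IH phi psi E; congr (_ + _ *: _).
  apply: cutsum_ext => y z Ew; apply: E.
  by rewrite -Ew !wdeg_cons tag_mm_app wdeg_cat wdeg_cons; ring.
by apply: IH => u Eu; apply: E; rewrite !wdeg_cons Eu addrA.
Qed.

(** The coderivation never produces the empty word. *)
Lemma coder_pull_ext_cons (W : lmodType K) (phi psi : seq (letter V) -> W) w :
  (forall b u, phi (b :: u) = psi (b :: u)) -> coder_pull m phi w =
    coder_pull m psi w.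
Proof.
case: w => //= a w E; congr (_ + _ *: _); first by apply: cutsum_ext.
by apply: coder_pull_ext => u _.
Qed.

Lemma coder_pullD (W : lmodType K) (phi psi : seq (letter V) -> W) w :
  coder_pull m (fun u => phi u + psi u) w =
    coder_pull m phi w + coder_pull m psi w.
Proof.
elim: w phi psi => [|a w IH] phi psi /=; first by rewrite addr0.
by rewrite cutsumD IH scalerDr addrACA.
Qed.

Lemma coder_pull_lin (U W : lmodType K) (L : U -> W) phi w :
  linear L -> L (coder_pull m phi w) = coder_pull m (fun u => L (phi u)) w.
Proof.
move=> hL; elim: w phi => [|a w IH] phi /=; first exact: lin0.
by rewrite linD // linZ // IH (cutsum_lin _ _ hL).
Qed.

Lemma coder_pullZ (W : lmodType K) (phi : seq (letter V) -> W) c w :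
  coder_pull m (fun u => c *: phi u) w = c *: coder_pull m phi w.
Proof.
symmetry; apply: (coder_pull_lin (L := fun x : W => c *: x)) => a x y.
by rewrite scalerDr !scalerA mulrC.
Qed.

Lemma coder_pullN (W : lmodType K) (phi : seq (letter V) -> W) w :
  coder_pull m (fun u => - phi u) w = - coder_pull m phi w.
Proof.
by rewrite -scaleN1r -coder_pullZ; apply: coder_pull_ext => u _;
  rewrite scaleN1r.
Qed.

Lemma coder_pull0 (W : lmodType K) w : coder_pull m (fun _ => 0 : W) w = 0.
Proof. by elim: w => //= a w ->; rewrite cutsum0 scaler0 addr0. Qed.

(** The co-Leibniz rule: in the word that the coderivation produces, a cut falls
    either to the right or to the left of the inserted output. *)
Lemma coder_pull_cutsum (W : lmodType K)
    (chi : seq (letter V) -> seq (letter V) -> W) w :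
  coder_pull m (cutsum chi) w =
  cutsum (fun x z => coder_pull m (chi^~ z) x + wsign x *: coder_pull m (chi x)
    z) w.
Proof.
elim: w chi => [|a w IH] chi /=; first by rewrite scaler0 addr0.
rewrite wsign_nil scale1r add0r coder_pullD cutsumD scalerDr addrACA IH.
congr (_ + _); symmetry.
rewrite (cutsum_ext (H := fun x z =>
  cutsum (fun y x2 => chi (mm_app m (a :: y) :: x2) z) x +
  (-1) ^ tag a *: (coder_pull m (fun u => chi (a :: u) z) x +
      wsign x *: coder_pull m (chi (a :: x)) z))); last first.
  by move=> x z _; rewrite wsign_cons -scalerA -addrA -scalerDr.
by rewrite cutsumD cutsumZ cutsum_assoc.
Qed.

End Fixm.
End CoderivationPullback.

Section CoderivationSquare.
Variables (K : fieldType) (V : int -> lmodType K).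

Lemma coder_pull_mm_app (V' : int -> lmodType K) (W : lmodType K) p
    (m : mmaps V V 1) (f : mmaps V V' p) (phi : seq (letter V') -> W) s e w :
  multilinear phi -> e = wdeg w + 1 + p ->
  coder_pull m (fun u => phi (mm_app f u :: s)) w =
    phi (homog (coder_pull m (f e) w) :: s).
Proof.
move=> h De.
rewrite (coder_pull_lin m (f e) w (linear_slot1 s (d := e) h)).
by apply: coder_pull_ext => u Eu; rewrite (@mm_app_homog _ _ _ _ _ _ e) // Eu
  De.
Qed.

Variable m : mmaps V V 1.

(** For a multilinear [phi] the empty block may be added, since its output is
    zero.  This makes the sum a full [cutsum], to which the co-Leibniz rule
    applies. *)
Lemma coder_pull_head (W : lmodType K) (phi : seq (letter V) -> W) w :
  multilinear phi ->
  coder_pull m phi w = cutsum (fun y z => phi (mm_app m y :: z)) w +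
    (if w is a :: w' then (-1) ^ tag a *: coder_pull m (fun u => phi (a :: u))
      w'
     else 0).
Proof.
move=> h; case: w => [|a w] /=; last first.
  by rewrite (mm_app_nil [::] _ _ h) add0r.
by rewrite (mm_app_nil [::] _ _ h) addr0.
Qed.

(** The square of a coderivation.  Two disjoint blocks are replaced in either
    order, with opposite signs as both operations have degree one; nested blocks
    add up to the relation of [m], applied inside a single slot of [phi]. *)
Lemma coder_pull_square :
  (forall e w, coder_pull m (m e) w = 0) ->
  forall (W : lmodType K) (phi : seq (letter V) -> W) w,
  multilinear phi -> coder_pull m (coder_pull m phi) w = 0.
Proof.
move=> m2 W phi w; elim: w phi => [|a w IH] phi h //.
pose tl u := if u is b :: u' then
  (-1) ^ tag b *: coder_pull m (fun v => phi (b :: v)) u' else 0.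
rewrite (coder_pull_ext m (psi := fun u =>
  cutsum (fun y z => phi (mm_app m y :: z)) u + tl u)); last first.
  by move=> u _; rewrite coder_pull_head.
rewrite coder_pullD coder_pull_cutsum.
rewrite (cutsum_ext (H := fun x z => if x is [::] then 0 else
    wsign x *: coder_pull m (fun v => phi (mm_app m x :: v)) z)); last first.
  move=> x z _; rewrite (coder_pull_mm_app m m z h (erefl _)) m2.
  rewrite (multilinear_zero [::] _ _ h) add0r; case: x => //.
  rewrite (coder_pull_ext m (psi := fun _ => 0)) ?coder_pull0 ?scaler0 //.
  by move=> u _; exact: (mm_app_nil [::] _ _ h).
rewrite /= add0r coder_pullZ IH; last exact: multilinear_cons.
rewrite !scaler0 addr0 -cutsumD -[RHS](cutsum0 _ w); apply: cutsum_ext => y z _.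
rewrite signD -/(wsign (a :: y)) expr1z -scalerDl.
by rewrite mulrN1 subrr scale0r.
Qed.

(** In the double sum the terms with j = 0 are the blocks that start at the
    first letter, met in order of decreasing length. *)
Lemma coder_sumE (W : lmodType K) (phi : seq (letter V) -> W) w :
  \sum_(1 <= k < (size w).+1) \sum_(0 <= j < k)
    koszul j w *: phi (insert m j ((size w).+1 - k) w) = coder_pull m phi w.
Proof.
elim: w phi => [|a w IH] phi; first by rewrite big_geq.
rewrite big_add1 /=.
rewrite (eq_big_nat _ _ (F2 := fun k =>
  phi (mm_app m (a :: take (size w - k) w) :: drop (size w - k) w) +
  \sum_(0 <= j < k) (-1) ^ tag a *: (koszul j w *:
     phi (a :: insert m j ((size w).+1 - k) w)))); last first.
  move=> k /andP[_ lk]; rewrite big_nat_recl // subSS.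
  congr (_ + _).
    rewrite /koszul take0 wdeg_nil expr0z scale1r /insert take0 drop0 add0n.
    by rewrite subSn //=.
  apply: eq_bigr => j _.
  by rewrite /koszul /= wdeg_cons signD -scalerA.
rewrite big_split /=; congr (_ + _).
  rewrite cutsum_takedrop [RHS]big_nat_rev /=;
    apply: eq_big_nat => k /andP[_ lk].
  by rewrite add0n subSS.
rewrite big_ltn // big_geq // add0r -IH scaler_sumr; apply: eq_bigr => k _.
by rewrite scaler_sumr.
Qed.

Lemma ainf_relationP : ainf_relation m <-> forall e w, coder_pull m (m e) w = 0.
Proof.
split=> h.
  by move=> e [|a w] //; rewrite -coder_sumE h.
by move=> w e _; rewrite coder_sumE h.
Qed.

Lemma coder_wordE w : coder_word m w = coder_pull m (@tens _ _) w.
Proof. exact: coder_sumE. Qed.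

Lemma multilinear_coder_pull (W : lmodType K) (phi : seq (letter V) -> W) :
  multilinear phi -> multilinear (coder_pull m phi).
Proof.
move=> h d s1 s2 a x y; rewrite -!coder_sumE.
rewrite (size_slot _ _ (homog (a *: x + y)) (homog x)).
rewrite (size_slot _ _ (homog y) (homog x)).
set n := size _.
suff E : multilinear (fun w => \sum_(1 <= k < n.+1) \sum_(0 <= j < k)
    koszul j w *: phi (insert m j (n.+1 - k) w)) by exact: E.
apply: multilinear_sum => k _; apply: multilinear_sum => j _.
exact/insert_multilinear.
Qed.

End CoderivationSquare.

Section AinfSquare.
Variables (K : fieldType) (A : ainf_algebra K).
Local Notation mA := (ainf_ops A).

Lemma ainf_square e w : coder_pull mA (mA e) w = 0.
Proof. by case: (ainf_relationP mA) => h _; rewrite h //; exact: ainf_opsP. Qed.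

Lemma ops_square e (o : letter A) : mA e [:: mm_app mA [:: o]] = 0.
Proof.
by have := ainf_square e [:: o]; rewrite coder_pull_cons /= scaler0 addr0.
Qed.

End AinfSquare.

Section CoalgebraPullback.
Variables (K : fieldType) (V V' : int -> lmodType K).

Definition coalg_pull (f : mmaps V V' 0) (W : lmodType K)
    (phi : seq (letter V') -> W) (w : seq (letter V)) : W :=
  \sum_(i < (size w).+1)
    \sum_(c : i.-tuple 'I_(size w).+1 | composition c)
      phi (fblocks f [seq val b | b <- c] w).

(** The compositions of [n] as plain lists, independent of the bound and of the
    number of blocks carried by the tuple types: a first block can then be
    removed. *)
Definition compositions (n : nat) : seq (seq nat) :=
  [seq [seq val b | b <- val c] | i : 'I_n.+1 <- enum 'I_n.+1,
     c : i.-tuple 'I_n.+1 <- enum [pred c : i.-tuple 'I_n.+1 | composition c]].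

Lemma mem_compositions n (c : seq nat) :
  (c \in compositions n) = (0%N \notin c) && (sumn c == n).
Proof.
apply/allpairsPdep/idP => [[i [t [_ ht ->]]]|/andP[h0 /eqP hs]].
  by move: ht; rewrite mem_enum.
have szc : (size c <= n)%N.
  rewrite -hs; elim: c h0 {hs} => //= b c IH;
    rewrite inE negb_or => /andP[hb hc].
  by rewrite -add1n leq_add ?IH // lt0n eq_sym.
have lec b : b \in c -> (b < n.+1)%N.
  rewrite ltnS -hs; elim: c {h0 hs szc} => //= b' c IH.
  by rewrite inE => /orP[/eqP ->|/IH h]; rewrite ?leq_addr // (leq_trans h) //
    leq_addl.
have Es : size (map (@inord n) c) == size c by rewrite size_map.
exists (Ordinal (szc : size c < n.+1)%N), (Tuple Es); rewrite !mem_enum.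
have Ec : [seq val b | b <- map (@inord n) c] = c.
  by rewrite -map_comp -[RHS]map_id; apply/eq_in_map => b hb /=;
    rewrite inordK ?lec.
by split; rewrite ?Ec // /in_mem /= /composition /= Ec h0 hs eqxx.
Qed.

Lemma uniq_compositions n : uniq (compositions n).
Proof.
apply: allpairs_uniq_dep; first exact: enum_uniq.
  by move=> i _; exact: enum_uniq.
move=> [i s] [j t] _ _ /= E.
have Eij : i = j.
  by apply: val_inj; move: (congr1 size E); rewrite !size_map !size_tuple.
case: _ / Eij t E => t E; congr (Tagged _ _).
by apply: val_inj; apply: (inj_map val_inj).
Qed.

Variable f : mmaps V V' 0.

Lemma coalg_pullE (W : lmodType K) (phi : seq (letter V') -> W) w :
  coalg_pull f phi w = \sum_(c <- compositions (size w)) phi (fblocks f c w).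
Proof.
rewrite big_allpairs_dep [RHS]big_enum; apply: eq_bigr => i _.
by rewrite [RHS]big_enum.
Qed.

Lemma coalg_pull_nil (W : lmodType K) (phi : seq (letter V') -> W) :
  coalg_pull f phi [::] = phi [::].
Proof.
rewrite coalg_pullE (perm_big [:: [::]]) ?big_seq1 //.
apply: uniq_perm; rewrite ?uniq_compositions // => c.
rewrite mem_compositions inE; case: c => [|[|b] c] //=.
by rewrite andbF.
Qed.

(** A composition of a nonempty word is a first block followed by a composition
    of the rest; both lists of compositions are duplicate free with the same
    elements. *)
Lemma coalg_pull_cons (W : lmodType K) (phi : seq (letter V') -> W) a w :
  coalg_pull f phi (a :: w) =
  cutsum (fun x z => coalg_pull f (fun u => phi (mm_app f (a :: x) :: u)) z) w.
Proof.
rewrite coalg_pullE cutsum_takedrop.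
rewrite (perm_big [seq b.+1 :: c | b <- iota 0 (size w).+1,
                                   c <- compositions (size w - b)]).
  rewrite big_allpairs_dep /= /index_iota subn0; apply: eq_bigr => b _.
  by rewrite coalg_pullE size_drop.
apply: uniq_perm; first exact: uniq_compositions.
  apply: allpairs_uniq_dep; first exact: iota_uniq.
    by move=> b _; exact: uniq_compositions.
  by move=> [b s] [c t] _ _ /= [-> ->].
move=> c; rewrite mem_compositions; apply/andP/allpairsPdep.
  case: c => [|[|b] c] [] //=; rewrite inE /= => hc /eqP hs.
  exists b, c; rewrite -[_ \in _ :: _]/(b \in iota 0 (size w).+1) mem_iota.
  by rewrite mem_compositions hc /=; split=> //; lia.
move=> [b [c' [hb hc ->]]]; move: hb hc; rewrite mem_iota mem_compositions.
move=> /andP[_ hb] /andP[hc /eqP hs]; split; first by rewrite inE.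
by rewrite /= hs; lia.
Qed.

End CoalgebraPullback.

(** * Pullback along a coalgebra map, and the defect of a morphism *)

(** The recursion of [coalg_pull_cons] goes to an arbitrary proper suffix, so
    structural induction does not suffice. *)
Lemma seq_size_ind T (P : seq T -> Prop) :
  P [::] -> (forall a w, (forall z, (size z <= size w)%N -> P z) ->
    P (a :: w)) ->
  forall w, P w.
Proof.
move=> P0 PS w; have [n] := ubnP (size w).
elim: n w => [|n IH] [|a w] //= le; apply: PS => z lez.
by apply: IH; apply: leq_ltn_trans lez _.
Qed.

Lemma size_rcut T (x z w : seq T) : x ++ z = w -> (size z <= size w)%N.
Proof. by move=> <-; rewrite size_cat leq_addl. Qed.

Section CoalgebraPullbackTheory.
Variables (K : fieldType) (V V' : int -> lmodType K) (f : mmaps V V' 0).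

Lemma coalg_pull_ext (W : lmodType K) (phi psi : seq (letter V') -> W) w :
  (forall u, wdeg u = wdeg w -> phi u = psi u) -> coalg_pull f phi w =
    coalg_pull f psi w.
Proof.
elim/seq_size_ind: w phi psi => [|a w IH] phi psi E.
  by rewrite !coalg_pull_nil E // /wdeg !big_nil.
rewrite !coalg_pull_cons; apply: cutsum_ext => x z Ew.
apply: IH => [|u Eu]; first exact: size_rcut Ew.
by apply: E; rewrite -Ew !wdeg_cons Eu tag_mm_app wdeg_cons wdeg_cat addr0
  addrA.
Qed.

Lemma coalg_pull_lin (U W : lmodType K) (L : U -> W) phi w :
  linear L -> L (coalg_pull f phi w) = coalg_pull f (fun u => L (phi u)) w.
Proof. by move=> hL; rewrite !coalg_pullE lin_sum. Qed.

Lemma coalg_pullD (W : lmodType K) (phi psi : seq (letter V') -> W) w :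
  coalg_pull f (fun u => phi u + psi u) w =
    coalg_pull f phi w + coalg_pull f psi w.
Proof. by rewrite !coalg_pullE big_split. Qed.

Lemma coalg_pullZ (W : lmodType K) c (phi : seq (letter V') -> W) w :
  coalg_pull f (fun u => c *: phi u) w = c *: coalg_pull f phi w.
Proof. by rewrite !coalg_pullE scaler_sumr. Qed.

Lemma coalg_pull0 (W : lmodType K) w : coalg_pull f (fun _ => 0 : W) w = 0.
Proof. by rewrite coalg_pullE big1. Qed.

Lemma coalg_pull_wsign (W : lmodType K) (phi : seq (letter V') -> W) w :
  coalg_pull f (fun u => wsign u *: phi u) w = wsign w *: coalg_pull f phi w.
Proof. by rewrite -coalg_pullZ; apply: coalg_pull_ext => u Eu;
  rewrite /wsign Eu. Qed.

(** Compatibility with the coproducts: a cut of the image falls between two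
    blocks, hence comes from a cut of the word. *)
Lemma coalg_pull_cutsum (W : lmodType K)
    (chi : seq (letter V') -> seq (letter V') -> W) w :
  coalg_pull f (cutsum chi) w =
  cutsum (fun u v => coalg_pull f (fun Y => coalg_pull f (chi Y) v) u) w.
Proof.
elim/seq_size_ind: w chi => [|a w IH] chi; first by rewrite /= !coalg_pull_nil.
rewrite [RHS]/= coalg_pull_nil !coalg_pull_cons -cutsumD.
rewrite (cutsum_ext (H := fun x z =>
  coalg_pull f (fun u => chi [::] (mm_app f (a :: x) :: u)) z +
  cutsum (fun u v =>
    coalg_pull f (fun Y => coalg_pull f (chi (mm_app f (a :: x) :: Y)) v) u)
      z));
  last first.
  by move=> x z Ew; rewrite -IH ?coalg_pullD //; exact: size_rcut Ew.
rewrite !cutsumD -cutsum_assoc; congr (_ + _); apply: cutsum_ext => u v _.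
by rewrite coalg_pull_cons.
Qed.

Lemma multilinear_coalg_pull (W : lmodType K) (phi : seq (letter V') -> W) :
  multilinear phi -> multilinear (coalg_pull f phi).
Proof.
move=> h d s1 s2 a x y; rewrite !coalg_pullE.
rewrite (size_slot _ _ (homog (a *: x + y)) (homog x)).
rewrite (size_slot _ _ (homog y) (homog x)).
rewrite scaler_sumr -big_split !big_seq; apply: eq_bigr => c /=.
rewrite mem_compositions => /andP[_ /eqP sc].
apply: (fblocks_slot f [::]) => //.
by rewrite sc size_cat /= addnS ltnS leq_addr.
Qed.

Lemma coalg_pull_mm_app (V'' : int -> lmodType K) (W : lmodType K) p
    (g : mmaps V' V'' p) (phi : seq (letter V'') -> W) s1 s2 e w :
  multilinear phi -> e = wdeg w + p ->
  coalg_pull f (fun u => phi (s1 ++ mm_app g u :: s2)) w =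
  phi (s1 ++ homog (coalg_pull f (g e) w) :: s2).
Proof.
move=> h De.
rewrite (coalg_pull_lin (g e) w (linear_slot s1 s2 (d := e) h)).
by apply: coalg_pull_ext => u Eu; rewrite (@mm_app_homog _ _ _ _ _ _ e) // Eu
  De.
Qed.

Lemma coalg_pull_letter (W : lmodType K) (phi : seq (letter V') -> W) a :
  coalg_pull f phi [:: a] = phi [:: mm_app f [:: a]].
Proof. by rewrite coalg_pull_cons /= coalg_pull_nil. Qed.

(** Recursion on the last block instead of the first.  The empty last block
    contributes zero, which is why [phi] is multilinear and the empty word has a
    term of its own. *)
Lemma coalg_pull_last (W : lmodType K) (phi : seq (letter V') -> W) w :
  multilinear phi ->
  coalg_pull f phi w = cutsum (fun x y => coalg_pull f
    (fun u => phi (rcons u (mm_app f y))) x) w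
     + (if w is [::] then phi [::] else 0).
Proof.
elim/seq_size_ind: w phi => [|a w IH] phi h.
  by rewrite /= !coalg_pull_nil /= (mm_app_nil [::] [::] f h) add0r.
rewrite coalg_pull_cons /= coalg_pull_nil addr0 /=.
rewrite (cutsum_ext (H := fun x z =>
    cutsum (fun z1 y => coalg_pull f (fun u =>
       phi (mm_app f (a :: x) :: rcons u (mm_app f y))) z1) z +
    (if z is [::] then phi [:: mm_app f (a :: x)] else 0))); last first.
  by move=> x z Ew; rewrite IH ?(size_rcut Ew) //; exact: multilinear_cons.
rewrite cutsumD addrC; congr (_ + _).
  rewrite cutsum_rcut -[RHS]add0r -[in RHS](cutsum0 _ w); congr (_ + _).
  by apply: cutsum_ext => x [].
rewrite -cutsum_assoc; apply: cutsum_ext => x y _.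
by rewrite coalg_pull_cons.
Qed.

(** The values of the coalgebra map on a word involve [f] only on blocks of that
    word. *)
Lemma coalg_pull_congr (g : mmaps V V' 0) (W : lmodType K)
    (phi : seq (letter V') -> W) w :
  (forall e u, (size u <= size w)%N -> f e u = g e u) ->
  coalg_pull f phi w = coalg_pull g phi w.
Proof.
elim/seq_size_ind: w phi => [|a w IH] phi E; first by rewrite !coalg_pull_nil.
rewrite !coalg_pull_cons; apply: cutsum_ext => x z Ew.
have sz := size_rcut Ew.
rewrite /mm_app E; last by rewrite /= -Ew size_cat ltnS leq_addr.
by apply: IH => // e u leu; apply: E; apply: leq_trans (leq_trans leu sz) _.
Qed.

End CoalgebraPullbackTheory.

(** When [phi] kills words of one letter, only decompositions into two or more
    blocks contribute, so proper blocks suffice. *)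
Lemma coalg_pull_congr_lt (K : fieldType) (V V' : int -> lmodType K)
    (f g : mmaps V V' 0) (W : lmodType K) (phi : seq (letter V') -> W) w :
  (forall e u, (size u < size w)%N -> f e u = g e u) ->
  (forall o, phi [:: o] = 0) -> coalg_pull f phi w = coalg_pull g phi w.
Proof.
case: w => [|a w] E phi1; first by rewrite !coalg_pull_nil.
rewrite !coalg_pull_cons; apply: cutsum_ext => x [|b z] Ew.
  by rewrite !coalg_pull_nil !phi1.
rewrite /mm_app E; last by rewrite /= -Ew size_cat /= -addSnnS leq_addr.
apply: coalg_pull_congr => e u leu; apply: E; apply: leq_ltn_trans leu _.
by rewrite /= ltnS; exact: size_rcut Ew.
Qed.

Section Error.
Variables (K : fieldType) (V V' : int -> lmodType K) (f : mmaps V V' 0).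
Variables (m : mmaps V V 1) (m' : mmaps V' V' 1).

(** The components of F m' - m F, for the coalgebra map F of [f]; [f] is a
    morphism when they vanish. *)
Definition defect e w : V' e := coalg_pull f (m' e) w - coder_pull m (f e) w.

(** The difference F m' - m F is a coderivation along F, determined by its
    components.  If these vanish on shorter words, then in the expansion over
    blocks only the whole word is left. *)
Lemma defect_pull (W : lmodType K) (phi : seq (letter V') -> W) w :
  multilinear phi ->
  (forall u, (size u < size w)%N -> forall e, defect e u = 0) ->
  coalg_pull f (coder_pull m' phi) w - coder_pull m (coalg_pull f phi) w =
  phi [:: homog (defect (wdeg w + 1) w)].
Proof.
elim/seq_size_ind: w phi => [|a w IH] phi h D0.
  rewrite !coalg_pull_nil /= subr0 /defect coalg_pull_nil /= subr0 mm_nil.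
  by rewrite (multilinear_zero [::] [::] _ h).
rewrite (coalg_pull_ext f (psi := fun w => cutsum
  (fun y z => phi (mm_app m' y :: z)) w +
    (if w is a :: w' then (-1) ^ tag a *: coder_pull m' (fun u => phi (a :: u))
      w'
     else 0))); last by move=> u _; rewrite coder_pull_head.
rewrite coalg_pullD coalg_pull_cutsum.
rewrite (coder_pull_ext_cons m (psi := cutsum (fun x z =>
  coalg_pull f (fun u => phi (mm_app f x :: u)) z))); last first.
  move=> b u; rewrite coalg_pull_cons /=;
    rewrite (coalg_pull_ext f (psi := fun _ => 0)).
    by rewrite coalg_pull0 add0r.
  by move=> v _; exact: (mm_app_nil [::] _ _ h).
rewrite coder_pull_cutsum.
pose psi z v := coalg_pull f (fun Y => phi (v ++ Y)) z.
have hpsi z : multilinear (psi z).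
  move=> d s1 s2 c x y; rewrite /psi !coalg_pullE.
  rewrite scaler_sumr -big_split; apply: eq_bigr => b _.
  exact: (multilinear_cat [::] (fblocks f b z) h s1 s2 c x y).
rewrite (cutsum_ext (H := fun u v =>
    psi v [:: homog (coalg_pull f (m' (wdeg u + 1)) u)])); last first.
  move=> u v _.
  by rewrite -(coalg_pull_mm_app f m' [::] [::] (hpsi v) (erefl _)).
rewrite cutsumD opprD addrACA.
rewrite (cutsum_ext (G := fun x z => coder_pull m _ x) (H := fun u v =>
    psi v [:: homog (coder_pull m (f (wdeg u + 1)) u)])); last first.
  move=> u v _.
  by rewrite -(coder_pull_mm_app m f [::] (hpsi v)) // addr0.
rewrite -cutsumN -cutsumD.
rewrite (cutsum_ext (H := fun u v => psi v [:: homog (defect (wdeg u + 1) u)]));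
  last first.
  move=> u v _; rewrite /defect.
  by rewrite -(linB _ _ (linear_slot1 [::] (hpsi v))).
rewrite cutsum_rcut (cutsum_ext (H := fun _ _ => 0)); last first.
  move=> u [|b v] // Ew; rewrite D0 ?(multilinear_zero [::] [::] _ (hpsi _)) //.
  by rewrite -Ew size_cat /= -addSnnS leq_addr.
rewrite cutsum0 add0r {1}/psi coalg_pull_nil -[RHS]addr0; congr (_ + _).
rewrite (cutsum_ext (H := fun x z => if x is [::] then 0 else
    wsign x *: coder_pull m (coalg_pull f (fun u => phi (mm_app f x :: u)))
      z)); last first.
  case=> // z _; rewrite (coder_pull_ext m (psi := fun _ => 0)) ?coder_pull0
    ?scaler0 //.
  move=> u _; rewrite (coalg_pull_ext f (psi := fun _ => 0)) ?coalg_pull0 //.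
  by move=> v _; exact: (mm_app_nil [::] _ _ h).
rewrite coalg_pull_cons [X in _ - X]/= add0r -cutsumN -cutsumD.
rewrite -[RHS](cutsum0 _ w); apply: cutsum_ext => x z Ew.
have lez := size_rcut Ew.
rewrite coalg_pullZ tag_mm_app addr0 -/(wsign (a :: x)) -scalerBr IH //;
  last first.
- by move=> u lu; apply: D0; apply: ltn_trans lu _.
- exact: multilinear_cons.
by rewrite D0 // (multilinear_zero [:: _] _ _ h) scaler0.
Qed.

Lemma defect_deg e w : e != wdeg w + 1 -> defect e w = 0.
Proof.
move=> ne; rewrite /defect (coalg_pull_ext f (psi := fun _ => 0)); last first.
  by move=> u Eu; rewrite mm_deg // Eu.
rewrite (coder_pull_ext m (psi := fun _ => 0)) ?coder_pull0 ?coalg_pull0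
  ?subr0 //.
by move=> u Eu; rewrite mm_deg // Eu addr0.
Qed.

Lemma morphism_pull (W : lmodType K) (phi : seq (letter V') -> W) w :
  (forall e u, defect e u = 0) -> multilinear phi ->
  coalg_pull f (coder_pull m' phi) w = coder_pull m (coalg_pull f phi) w.
Proof.
move=> D0 h; apply/eqP; rewrite -subr_eq0 defect_pull // D0.
by rewrite (multilinear_zero [::] [::] _ h).
Qed.

Lemma defect_letter e o : defect e [:: o] = 0 ->
  f e [:: mm_app m [:: o]] = m' e [:: mm_app f [:: o]].
Proof.
rewrite /defect coalg_pull_letter coder_pull_cons /= scaler0 addr0 => /eqP.
by rewrite subr_eq0 => /eqP ->.
Qed.

End Error.

Lemma lcomp_mm_app (K : fieldType) (V V' : int -> lmodType K) p
    (f : mmaps V V' p) e w : lcomp e (mm_app f w) = f e w.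
Proof.
case: (e =P wdeg w + p) => [->|/eqP ne]; first exact: lcomp_homog.
rewrite mm_deg // /lcomp /=; case: eqP => // E.
by rewrite E eqxx in ne.
Qed.

Lemma wcomp_mm_app (K : fieldType) (V V' : int -> lmodType K) p
    (f : mmaps V V' p) e w : wcomp e [:: mm_app f w] = f e w.
Proof. exact: lcomp_mm_app. Qed.

Lemma wcomp_deg (K : fieldType) (V : int -> lmodType K) e (w : seq (letter V))
    : e != wdeg w -> wcomp e w = 0.
Proof.
case: w => [|o [|]] //= ne; rewrite /lcomp; case: eqP => // E.
by rewrite -E /wdeg big_seq1 eqxx in ne.
Qed.

Section Components.
Variables (K : fieldType) (V V' : int -> lmodType K).

Lemma coder_pull_wcomp (U : int -> lmodType K) (m : mmaps U U 1) e w :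
    coder_pull m (wcomp e) w = m e w.
Proof.
case: w => [|a w]; first by rewrite mm_nil.
rewrite coder_pull_cons (coder_pull_ext_cons m (psi := fun _ => 0)) //
  coder_pull0 scaler0 addr0.
rewrite cutsum_rcut wcomp_mm_app -[RHS]add0r -[in RHS](cutsum0 _ w).
by congr (_ + _); apply: cutsum_ext => x [].
Qed.

(** Words of one letter arise only from the composition with a single block. *)
Lemma coalg_pull_single (f : mmaps V V' 0) (W : lmodType K)
    (phi : seq (letter V') -> W) w :
  (forall u, size u != 1%N -> phi u = 0) ->
  coalg_pull f phi w = if w is [::] then 0 else phi [:: mm_app f w].
Proof.
move=> h; case: w => [|a w]; first by rewrite coalg_pull_nil h.
rewrite coalg_pull_cons cutsum_rcut coalg_pull_nil -[RHS]add0r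
  -[in RHS](cutsum0 _ w).
congr (_ + _); apply: cutsum_ext => x [|b z] // _.
rewrite coalg_pull_cons -[RHS](cutsum0 _ z); apply: cutsum_ext => y t _.
by rewrite (coalg_pull_ext f (psi := fun _ => 0)) ?coalg_pull0 // => u _;
  rewrite h.
Qed.

Lemma coalg_pull_wcomp (f : mmaps V V' 0) e w : coalg_pull f (wcomp e) w =
    f e w.
Proof.
rewrite coalg_pull_single; last by case=> [|o [|]].
by case: w => [|a w]; rewrite ?mm_nil ?wcomp_mm_app.
Qed.

Lemma coalg_mapE (f : mmaps V V' 0) w : coalg_word f w =
    coalg_pull f (@tens _ _) w.
Proof. by []. Qed.

Lemma coalg_map_coder (m : mmaps V V 1) (f : mmaps V V' 0) w :
  coalg_map f (coder m (tens w)) = coder_pull m (coalg_pull f (@tens _ _)) w.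
Proof.
rewrite coder_tens coder_wordE (coder_pull_lin m (L := coalg_map f)).
  by apply: coder_pull_ext => u _; rewrite coalg_map_tens.
by move=> a x y; rewrite linearP.
Qed.

Lemma coder_coalg_map (m' : mmaps V' V' 1) (f : mmaps V V' 0) w :
  coder m' (coalg_map f (tens w)) = coalg_pull f (coder_pull m' (@tens _ _)) w.
Proof.
rewrite coalg_map_tens coalg_mapE (coalg_pull_lin f (L := coder m')).
  by apply: coalg_pull_ext => u _; rewrite coder_tens coder_wordE.
by move=> a x y; rewrite linearP.
Qed.

(** The components of the morphism equation are obtained by pairing it with
    [wcomp e]; conversely vanishing components give the equation paired with
    every multilinear function, in particular with [tens]. *)
Lemma coalg_mapP (m : mmaps V V 1) (m' : mmaps V' V' 1) (f : mmaps V V' 0) :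
  (forall x, coalg_map f (coder m x) = coder m' (coalg_map f x)) <->
  forall e w, defect f m m' e w = 0.
Proof.
split=> [h e w|h x].
  have wc e' V0 := tlift_linear (@wcomp_multilinear K V0 e').
  have := congr1 (tlift (wcomp e)) (h (tens w)).
  rewrite coalg_map_coder coder_coalg_map (coder_pull_lin m _ _ (wc _ _)).
  rewrite (coalg_pull_lin f _ _ (wc _ _)) /defect => E.
  apply/eqP; rewrite subr_eq0; apply/eqP.
  transitivity (coalg_pull f (fun u => tlift (wcomp e)
    (coder_pull m' (@tens _ _) u)) w).
    apply: coalg_pull_ext => u _; rewrite (coder_pull_lin m' _ _ (wc _ _))
      -(coder_pull_wcomp m').
    by apply: coder_pull_ext => v _; rewrite tlift_tens //;
      exact: wcomp_multilinear.
  rewrite -E; apply: coder_pull_ext => u _.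
  rewrite (coalg_pull_lin f _ _ (wc _ _)) -(coalg_pull_wcomp f).
  by apply: coalg_pull_ext => v _; rewrite tlift_tens //;
    exact: wcomp_multilinear.
apply: (tlift_uniq (g := coalg_map f \o coder m)
  (h := coder m' \o coalg_map f)).
move=> w /=; rewrite coalg_map_coder coder_coalg_map (morphism_pull _ h) //.
exact: tens_multilinear.
Qed.

End Components.

(** * Operations on a concatenation, and strict maps *)

Section Misc.
Variables (K : fieldType).

Lemma cutsum_cat T (W : zmodType) (G : seq T -> seq T -> W) u t v :
  cutsum G (u ++ t :: v) =
  cutsum (fun y z => G y (z ++ t :: v)) u +
  cutsum (fun y z => G (u ++ t :: y) z) v.
Proof. by elim: u G => //= b u IH G; rewrite IH addrA. Qed.

(** For a marked letter [t] in the word, the block lies before, contains, or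
    lies after [t]. *)
Lemma coder_pull_cat (V : int -> lmodType K) (m : mmaps V V 1) (W : lmodType K)
    (phi : seq (letter V) -> W) u t v :
  coder_pull m phi (u ++ t :: v) =
  coder_pull m (fun x => phi (x ++ t :: v)) u +
  cutsum (fun x y => wsign x *: cutsum (fun y' z =>
    phi (x ++ mm_app m (y ++ t :: y') :: z)) v) u +
  (wsign u * (-1) ^ tag t) *: coder_pull m (fun z => phi (u ++ t :: z)) v.
Proof.
elim: u phi => [|b u IH] phi.
  by rewrite cat0s coder_pull_cons /= wsign_nil scale1r add0r mul1r.
rewrite cat_cons !coder_pull_cons cutsum_cat IH /= wsign_nil scale1r wsign_cons.
rewrite !scalerDr scalerA mulrA -!addrA; congr (_ + _).
rewrite [RHS]addrCA; congr (_ + _); congr (_ + _); congr (_ + _).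
rewrite -cutsumZ; apply: cutsum_ext => x z _.
by rewrite wsign_cons scalerA.
Qed.

Lemma coder_pull_sum (V : int -> lmodType K) (m : mmaps V V 1) (W : lmodType K)
    I (r : seq I) (phi : I -> seq (letter V) -> W) w :
  coder_pull m (fun u => \sum_(i <- r) phi i u) w =
    \sum_(i <- r) coder_pull m (phi i) w.
Proof.
elim: r => [|i r IH].
  by rewrite big_nil -[RHS](coder_pull0 m _ w); apply: coder_pull_ext => u _;
    rewrite big_nil.
rewrite big_cons -IH -coder_pullD; apply: coder_pull_ext => u _.
by rewrite big_cons.
Qed.

Section Param.
Variables (V V' : int -> lmodType K) (f : mmaps V V' 0) (W : lmodType K).

Lemma coalg_pull_cutsum_param T (G : seq (letter V') -> seq T -> seq T -> W) v
    w :
  coalg_pull f (fun X => cutsum (G X) v) w =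
  cutsum (fun y z => coalg_pull f (fun X => G X y z) w) v.
Proof.
elim: v G => //= b v IH G; rewrite coalg_pullD; congr (_ + _).
exact: (IH (fun X x z => G X (b :: x) z)).
Qed.

Lemma coalg_pull_coder_pull_param (V'' : int -> lmodType K)
    (m : mmaps V'' V'' 1)
    (G : seq (letter V') -> seq (letter V'') -> W) v w :
  coalg_pull f (fun X => coder_pull m (G X) v) w =
    coder_pull m (fun z => coalg_pull f (G^~ z) w) v.
Proof.
rewrite coalg_pullE -coder_pull_sum; apply: coder_pull_ext => u _.
by rewrite coalg_pullE.
Qed.

(** The first tensor factors are mapped by [f], the last ones are given. *)
Definition coalg_pull_pre (phi : seq (letter V') -> W) w v :=
  coalg_pull f (fun X => phi (X ++ v)) w.

Lemma multilinear_coalg_pull_pre (phi : seq (letter V') -> W) w :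
  multilinear phi -> multilinear (coalg_pull_pre phi w).
Proof.
move=> h d s1 s2 c x y; rewrite /coalg_pull_pre !coalg_pullE.
rewrite scaler_sumr -big_split; apply: eq_bigr => b _.
by rewrite !catA h.
Qed.

End Param.
End Misc.

(* A degree zero linear map [L] between graded spaces acts on words letter by
   letter, as the coalgebra map with no higher components. *)
Section StrictMaps.
Variables (K : fieldType) (V V' : int -> lmodType K).
Variable L : forall d, V d -> V' d.
Hypothesis hL : forall d, linear (@L d).

Definition lmap (o : letter V) : letter V' := homog (L (tagged o)).

Lemma wdeg_lmap w : wdeg (map lmap w) = wdeg w.
Proof. by rewrite /wdeg big_map. Qed.

Lemma wsign_lmap w : wsign (map lmap w) = wsign w.
Proof. by rewrite /wsign wdeg_lmap. Qed.

Lemma multilinear_lmap (W : lmodType K) (phi : seq (letter V') -> W) :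
  multilinear phi -> multilinear (fun w => phi (map lmap w)).
Proof.
move=> h d s1 s2 a x y; rewrite !map_cat /= /lmap /= hL.
exact: h.
Qed.

Lemma lmap_mm_app (U U' : int -> lmodType K) p (f : mmaps U V p)
    (g : mmaps U' V' p) u u' :
  wdeg u = wdeg u' -> (forall e, L (f e u) = g e u') ->
  lmap (mm_app f u) = mm_app g u'.
Proof. by move=> Eu E; rewrite /lmap /= E /mm_app -Eu. Qed.

Lemma coder_pull_lmap (m : mmaps V V 1) (m' : mmaps V' V' 1) (W : lmodType K)
    (phi : seq (letter V') -> W) w :
  (forall e u, L (m e u) = m' e (map lmap u)) ->
  coder_pull m (fun u => phi (map lmap u)) w = coder_pull m' phi (map lmap w).
Proof.
move=> E; elim: w phi => // a w IH phi; rewrite map_cons !coder_pull_cons /=.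
congr (_ + _ *: _); last exact: (IH (fun u => phi (lmap a :: u))).
rewrite cutsum_map; apply: cutsum_ext => y z _.
by rewrite (lmap_mm_app (g := m') (u' := map lmap (a :: y))) ?wdeg_lmap.
Qed.

Lemma coalg_pull_lmap (U : int -> lmodType K) (f : mmaps U V 0)
    (g : mmaps U V' 0)
    (W : lmodType K) (phi : seq (letter V') -> W) w :
  (forall e u, L (f e u) = g e u) ->
  coalg_pull f (fun u => phi (map lmap u)) w = coalg_pull g phi w.
Proof.
move=> E; rewrite !coalg_pullE; apply: eq_bigr => c _; congr phi.
rewrite /fblocks -map_comp; apply: eq_map => b /=.
exact: lmap_mm_app.
Qed.

End StrictMaps.

(** * The algebra of homotopies *)

Section HomotopyAlgebra.
Variables (K : fieldType) (A B : ainf_algebra K) (F : mmaps A B 0).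
Local Notation mA := (ainf_ops A).
Local Notation mB := (ainf_ops B).
Hypothesis F_morph : forall e w, defect F mA mB e w = 0.

(** An element of degree d is a triple (a, b, s), where s stands for an element
    of the desuspension of B: hence the degree d - 1 in the third factor. *)
Definition path_space (d : int) : lmodType K := (A d * B d * B (d - 1))%type.
Local Notation D := path_space.

Definition path_left d (x : D d) : A d := x.1.1.
Definition path_right d (x : D d) : B d := x.1.2.
Definition path_htpy d (x : D d) : B (d - 1) := x.2.

Lemma path_left_linear d : linear (@path_left d). Proof. by []. Qed.
Lemma path_right_linear d : linear (@path_right d). Proof. by []. Qed.

Local Notation LA := (lmap path_left).
Local Notation LB := (lmap path_right).
Definition htpy_letter (o : letter D) : letter B :=
    homog (path_htpy (tagged o)).

(** One term F(x_A) s(t) (z'_B) of the homotopy formula, for z = t :: z': the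
    letters before [t] are mapped by [F] and those after it are kept. *)
Definition htpy_insert (W : lmodType K) (beta : seq (letter B) -> W) x z : W :=
  if z is t :: z' then coalg_pull_pre F beta (map LA x)
    (htpy_letter t :: map LB z') else 0.

(** The third component of the operations; [cutsum] picks the position of the
    letter that contributes its s-part.  The minus signs come from moving the
    desuspension past the operation. *)
Definition path_op (e : int) (w : seq (letter D)) : B e :=
  F e (map LA w) - wcomp e (map LB w) -
  cutsum (fun x z => wsign x *: htpy_insert (mB e) x z) w.

Lemma multilinear_htpy_insertl (W : lmodType K) (beta : seq (letter B) -> W) z :
  multilinear beta -> multilinear (fun x => htpy_insert beta x z).
Proof.
move=> h; case: z => [|t z]; first exact: multilinear0.
apply: (multilinear_lmap path_left_linear); apply: multilinear_coalg_pull.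
exact: (multilinear_cat [::]).
Qed.

Lemma multilinear_htpy_insertr (W : lmodType K) (beta : seq (letter B) -> W) x :
  multilinear beta -> multilinear (htpy_insert beta x).
Proof.
move=> h d [|t s1] s2 a y z /=; have hp :=
  multilinear_coalg_pull_pre F (map LA x) h.
  exact: (hp _ [::]).
rewrite !map_cat /= /lmap /= path_right_linear.
exact: (hp d (htpy_letter t :: map LB s1)).
Qed.

Lemma multilinear_path_op e : multilinear (path_op e).
Proof.
apply: multilinearD; first apply: multilinearD.
- exact/(multilinear_lmap path_left_linear)/mm_lin.
- exact/multilinearN/(multilinear_lmap path_right_linear)/wcomp_multilinear.
apply: multilinearN; apply: multilinear_cutsum => [z|x].
  exact/multilinear_wsign/multilinear_htpy_insertl/mm_lin.
apply: multilinear_comp; last exact/multilinear_htpy_insertr/mm_lin.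
by move=> c u v; rewrite scalerDr !scalerA mulrC.
Qed.

Lemma wdeg_htpy_letter x t z :
  wdeg (map LA x) + wdeg (htpy_letter t :: map LB z) = wdeg (x ++ t :: z) - 1.
Proof. by rewrite wdeg_cat !wdeg_cons !wdeg_lmap /=; ring. Qed.

Lemma path_op_deg e w : e != wdeg w -> path_op e w = 0.
Proof.
move=> ne; rewrite /path_op mm_deg ?wdeg_lmap ?addr0 //.
rewrite wcomp_deg ?wdeg_lmap // subrr sub0r.
rewrite (cutsum_ext (H := fun _ _ => 0)) ?cutsum0 ?oppr0 // => x [|t z] Ew /=.
  by rewrite scaler0.
rewrite /coalg_pull_pre (coalg_pull_ext F (psi := fun _ => 0)) ?coalg_pull0
  ?scaler0 //.
by move=> u Eu; rewrite mm_deg // wdeg_cat Eu wdeg_htpy_letter Ew subrK.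
Qed.

Definition path_mm (e : int) (w : seq (letter D)) : D e :=
  (mA e (map LA w), mB e (map LB w), path_op (e - 1) w).

Lemma path_mm_lin e : multilinear (path_mm e).
Proof.
move=> d s1 s2 a x y; rewrite /path_mm.
rewrite (multilinear_lmap path_left_linear (@mm_lin _ _ _ _ mA e)).
rewrite (multilinear_lmap path_right_linear (@mm_lin _ _ _ _ mB e)).
by rewrite multilinear_path_op.
Qed.

Lemma path_mm_deg e w : e != wdeg w + 1 -> path_mm e w = 0.
Proof.
move=> ne; rewrite /path_mm !mm_deg ?wdeg_lmap // path_op_deg //.
by rewrite subr_eq.
Qed.

Lemma path_mm_nil e : path_mm e [::] = 0.
Proof. by rewrite /path_mm !mm_nil /path_op /= mm_nil scaler0 !subr0. Qed.

Definition path_ops : mmaps D D 1 := MMaps path_mm_lin path_mm_deg path_mm_nil.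
Local Notation mD := path_ops.

Lemma htpy_letter_mm_app w : htpy_letter (mm_app mD w) =
    homog (path_op (wdeg w) w).
Proof. by rewrite /htpy_letter /path_htpy /=;
  rewrite -[in RHS](addrK 1 (wdeg w)). Qed.

(** Applies to the identity component -b of [path_op], which only sees blocks of
    one letter. *)
Lemma cutsum_single T (W : zmodType) (G : seq T -> seq T -> W) w :
  (forall x z, size x != 1%N -> G x z = 0) ->
  cutsum G w = if w is t :: z then G [:: t] z else 0.
Proof.
move=> G0; case: w => [|t z] /=; first exact: G0.
rewrite G0 // add0r; case: z => [|b z] //=.
rewrite -[RHS]addr0 -[in RHS](cutsum0 _ z); congr (_ + _).
by apply: cutsum_ext => x v _; exact: G0.
Qed.

(* The pullback of the homotopy formula along the operations of D.  When an
   output of the operations takes the marked position it contributes its three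
   parts ([path_term_F], [path_term_w], [path_term_insert]); when it lies
   before or after that position it gives [path_term_outer].  [P u v] is the
   term in which the letters of [u] are mapped by F and those of [v] are kept,
   [N u t v] sums the blocks around the marked letter [t]. *)
Section Beta.
Variables (W : lmodType K) (beta : seq (letter B) -> W).
Hypotheses (h : multilinear beta) (beta0 : forall w, coder_pull mB beta w = 0).
Local Notation psi x := (coalg_pull_pre F beta (map LA x)).
Let hpsi x : multilinear (psi x) := multilinear_coalg_pull_pre F (map LA x) h.

Let N u t v := coalg_pull F (fun U => cutsum (fun X Y => wsign Y *:
  cutsum (fun y z => beta (X ++ mm_app mB (Y ++ htpy_letter t :: y) :: z))
    (map LB v)) U) (map LA u).

Let P (u : seq (letter D)) v := psi u (map LB v).

(** The output f(y) completes F(x) to F(x ++ y) as its last block; only the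
    empty prefix is not reached in this way. *)
Lemma path_term_F w :
  cutsum (fun x z => cutsum (fun y z' =>
    psi x (homog (F (wdeg y) (map LA y)) :: map LB z')) z) w =
  cutsum P w - beta (map LB w).
Proof.
rewrite -cutsum_assoc; apply/eqP; rewrite eq_sym subr_eq; apply/eqP.
rewrite -[X in _ + X](_ : cutsum
   (fun u v => if u is [::] then beta (map LB v) else 0) w = _); last first.
  case: w => //= a w; rewrite -[RHS]addr0 -[in RHS](cutsum0 _ w).
  by congr (_ + _); apply: cutsum_ext.
rewrite -cutsumD; apply: cutsum_ext => u v _.
rewrite /P /coalg_pull_pre coalg_pull_last; last exact: (multilinear_cat [::]).
rewrite cutsum_map; congr (_ + _); last by case: u.
apply: cutsum_ext => x y _; apply: coalg_pull_ext => X _.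
rewrite cat_rcons (@mm_app_homog _ _ _ _ _ _ (wdeg y)) //.
by rewrite wdeg_lmap addr0.
Qed.

(** The output -b of one letter moves the boundary between the F-part and the
    kept part by one: together with [path_term_F] this telescopes. *)
Lemma path_term_w w :
  cutsum (fun x z => cutsum (fun y z' =>
    psi x (homog (wcomp (wdeg y) (map LB y)) :: map LB z')) z) w =
  cutsum P w - coalg_pull F beta (map LA w).
Proof.
rewrite (cutsum_rcut P).
have -> : P w [::] = coalg_pull F beta (map LA w).
  by apply: coalg_pull_ext => X _; rewrite cats0.
rewrite addrK; apply: cutsum_ext => x z _.
rewrite cutsum_single; last first.
  move=> [|b [|c y]] z' // _; exact: (multilinear_zero [::] _ _ (hpsi x)).
case: z => // t z; rewrite /P /=; congr (psi x (_ :: _)).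
by rewrite (_ : wdeg [:: t] = tag t) ?lcomp_homog // /wdeg big_seq1.
Qed.

(** Regrouping around the marked letter, the prefix of the block and the
    letters before the block are cut out of one word; the part before the
    marked letter is then handled by [coalg_pull_cutsum]. *)
Lemma path_term_insert w :
  cutsum (fun x z => cutsum (fun y z' => psi x (homog
    (cutsum (fun y1 y2 => wsign y1 *: htpy_insert (mB (wdeg y)) y1 y2) y) ::
      map LB z')) z) w =
  cutsum (fun u v => if v is t :: v' then N u t v' else 0) w.
Proof.
pose H x y1 y2 z' := wsign y1 *:
  psi x (homog (htpy_insert (mB (wdeg (y1 ++ y2))) y1 y2) :: map LB z').
transitivity (cutsum (fun u r => cutsum (fun x y1 =>
   cutsum (fun y2 z' => H x y1 y2 z') r) u) w).
  rewrite cutsum_assoc; apply: cutsum_ext => x z _.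
  rewrite -cutsum_assoc; apply: cutsum_ext => y z' _.
  rewrite (cutsum_lin _ _ (linear_slot1 _ (hpsi x)));
    apply: cutsum_ext => y1 y2 Ey.
  by rewrite /H Ey (linZ _ _ (linear_slot1 _ (hpsi x))).
have H0 x y1 z' : H x y1 [::] z' = 0.
  by rewrite /H /= (multilinear_zero [::] _ _ (hpsi x)) scaler0.
apply: cutsum_ext => u [|t v] _.
  by rewrite -[RHS](cutsum0 _ u); apply: cutsum_ext => x y1 _; exact: H0.
rewrite /N coalg_pull_cutsum cutsum_map; apply: cutsum_ext => x y1 _.
rewrite /= H0 add0r.
rewrite (coalg_pull_ext F (psi := fun X => wsign y1 *: cutsum (fun y z =>
   beta (X ++ homog (htpy_insert (mB (wdeg (y1 ++ t :: y))) y1 (t :: y)) :: map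
     LB z)) v));
   last first.
  move=> X _; rewrite coalg_pull_wsign wsign_lmap; congr (_ *: _).
  rewrite coalg_pull_cutsum_param cutsum_map; apply: cutsum_ext => y z Ev.
  rewrite /= /coalg_pull_pre (coalg_pull_lin F _ _ (linear_slot X _ h)).
  apply: coalg_pull_ext => Y EY; rewrite (@mm_app_homog _ _ _ _ _ _
    (wdeg (y1 ++ t :: y))) //.
  by rewrite wdeg_cat EY wdeg_htpy_letter subrK.
rewrite coalg_pullZ coalg_pull_cutsum_param -cutsumZ; exact: cutsum_ext.
Qed.

(** This is m m = 0 of B on the word F(u) t v, solved for the blocks that
    contain the marked letter. *)
Lemma path_term_outer u t v :
  coder_pull mD (fun x => wsign x *: htpy_insert beta x (t :: v)) u +
  (-1) ^ tag t *: coder_pull mD (fun z => htpy_insert beta u (t :: z)) v =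
    N u t v.
Proof.
have E U : coder_pull mB (fun x => beta (x ++ htpy_letter t :: map LB v)) U +
  cutsum (fun x y => wsign x *: cutsum (fun y' z =>
    beta (x ++ mm_app mB (y ++ htpy_letter t :: y') :: z)) (map LB v)) U +
  (wsign U * (-1) ^ tag (htpy_letter t)) *:
    coder_pull mB (fun z => beta (U ++ htpy_letter t :: z)) (map LB v) = 0.
  by rewrite -coder_pull_cat beta0.
pose X1 := coalg_pull F (coder_pull mB (fun x => beta
  (x ++ htpy_letter t :: map LB v))) (map LA u).
pose Y3 := coder_pull mD (fun z => htpy_insert beta u (t :: z)) v.
have T1 : coder_pull mD (fun x => wsign x *: htpy_insert beta x (t :: v)) u =
  - (wsign u *: X1).
  rewrite /X1 (morphism_pull _ F_morph); last exact: (multilinear_cat [::]).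
  rewrite -(coder_pull_lmap (L := path_left) (m := mD)) // -scaleNr
    -coder_pullZ.
  by apply: coder_pull_ext => x Ex; rewrite /wsign Ex signD expr1z mulrN1.
have T3 : coalg_pull F (fun U => (wsign U * (-1) ^ tag (htpy_letter t)) *:
    coder_pull mB (fun z => beta (U ++ htpy_letter t :: z)) (map LB v))
      (map LA u) =
    - ((wsign u * (-1) ^ tag t) *: Y3).
  rewrite /Y3 /= -/(coalg_pull_pre _ _ _)
    (coder_pull_lmap (L := path_right) (m := mD) (m' := mB)
    (fun z => psi u (htpy_letter t :: z))) // -coalg_pull_coder_pull_param
      -scaleNr -coalg_pullZ.
  apply: coalg_pull_ext => U EU; congr (_ *: _).
  rewrite -[in RHS](subrK 1 (tag t)) [in RHS]signD expr1z mulrN1 mulrN opprK.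
  by rewrite /wsign EU wdeg_lmap.
have T2 : N u t v = wsign u *: coalg_pull F
  (fun U => cutsum (fun x y => wsign x *:
    cutsum (fun y' z => beta (x ++ mm_app mB (y ++ htpy_letter t :: y') :: z))
      (map LB v)) U) (map LA u).
  rewrite -coalg_pullZ; apply: coalg_pull_ext => U EU; rewrite -cutsumZ.
  apply: cutsum_ext => X Y EXY; rewrite scalerA; congr (_ *: _).
  rewrite -(wsign_lmap path_left) /wsign -EU -EXY wdeg_cat signD mulrAC
    -/(wsign X) -/(wsign Y).
  by rewrite wsign_sqr mul1r.
have := coalg_pull0 F W (map LA u); rewrite -(coalg_pull_ext F
  (fun U _ => E U)) !coalg_pullD T3.
move/(congr1 (fun z => wsign u *: z)); rewrite !scalerDr -T2 scaler0 scalerN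
  scalerA.
rewrite mulrA wsign_sqr mul1r -/X1 T1 => E0.
by apply/eqP; rewrite -subr_eq0 -oppr_eq0 !opprD !opprK addrAC E0.
Qed.

(** The insertion terms cancel, and what is left is the difference of the two
    ends of the telescoping sum. *)
Lemma path_pull w :
  coder_pull mD (cutsum (fun x z => wsign x *: htpy_insert beta x z)) w =
  coalg_pull F beta (map LA w) - beta (map LB w).
Proof.
rewrite coder_pull_cutsum.
rewrite (cutsum_ext (H := fun x z =>
   (if z is t :: z' then N x t z' else 0) +
   (cutsum (fun y z' =>
      psi x (homog (F (wdeg y) (map LA y)) :: map LB z')) z -
    cutsum (fun y z' =>
      psi x (homog (wcomp (wdeg y) (map LB y)) :: map LB z')) z -
    cutsum (fun y z' => psi x (homog (cutsum (fun y1 y2 =>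
      wsign y1 *: htpy_insert (mB (wdeg y)) y1 y2) y) :: map LB z')) z)));
        last first.
  move=> x z _; rewrite coder_pullZ scalerA wsign_sqr scale1r.
  rewrite (coder_pull_head mD z (multilinear_htpy_insertr x h)).
  rewrite -!cutsumN -!cutsumD [cutsum _ z + _]addrC addrA.
  congr (_ + _).
    case: z => [|t z]; last by rewrite -path_term_outer.
    rewrite /= (coder_pull_ext mD (psi := fun _ => 0)) ?coder_pull0 ?addr0 //
      => u _.
    by rewrite scaler0.
  apply: cutsum_ext => y z' _.
  rewrite /htpy_insert htpy_letter_mm_app /path_op.
  by rewrite !(linB _ _ (linear_slot1 _ (hpsi x))).
rewrite !cutsumD !cutsumN path_term_F path_term_w path_term_insert.
by rewrite addrC subrK opprB addrC addrA subrK.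
Qed.

End Beta.

(** In the third component, [path_pull] leaves m(F(w_A)) - m(w_B); the first is
    compensated by f(m(w_A)) since F is a morphism, the second by the component
    -b. *)
Lemma path_relation e w : coder_pull mD (mD e) w = 0.
Proof.
have E1 : (coder_pull mD (mD e) w).1.1 = 0.
  rewrite (coder_pull_lin mD (L := fun x : D e => x.1.1)) //.
  by rewrite (coder_pull_lmap (L := path_left) (m' := mA)) // ainf_square.
have E2 : (coder_pull mD (mD e) w).1.2 = 0.
  rewrite (coder_pull_lin mD (L := fun x : D e => x.1.2)) //.
  by rewrite (coder_pull_lmap (L := path_right) (m' := mB)) // ainf_square.
have E3 : (coder_pull mD (mD e) w).2 = 0.
  rewrite (coder_pull_lin mD (L := fun x : D e => x.2)) //.
  set eb := e - 1.
  rewrite -[LHS]/(coder_pull mD (path_op eb) w) /path_op !coder_pullD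
    !coder_pullN.
  rewrite (path_pull (@mm_lin _ _ _ _ mB eb) (ainf_square eb)).
  rewrite (coder_pull_lmap (L := path_left) (m' := mA)) //
    (coder_pull_lmap (L := path_right) (m' := mB)) //.
  rewrite coder_pull_wcomp opprB addrA subrK.
  by have := F_morph eb (map LA w); rewrite /defect => /eqP;
    rewrite -oppr_eq0 opprB => /eqP.
by case: (coder_pull _ _ _) E1 E2 E3 => [[x y] z] /= -> -> ->.
Qed.

Definition path_algebra : ainf_algebra K :=
  AinfAlgebra (proj2 (ainf_relationP mD) path_relation).

End HomotopyAlgebra.

(** * Contraction of an acyclic complex *)

Section Contraction.
Variable K : fieldType.

(** A subspace maximal among those that meet [Z] in zero; a vector outside its
    sum with [Z] could be added to it. *)
Lemma subspace_complement (V : lmodType K) (Z : V -> Prop) :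
  Z 0 -> (forall a x y, Z x -> Z y -> Z (a *: x + y)) ->
  exists C : V -> Prop,
    [/\ C 0, forall a x y, C x -> C y -> C (a *: x + y),
        forall x, C x -> Z x -> x = 0 & forall x, exists2 c, C c & Z (x - c)].
Proof.
move=> Z0 Zlin.
pose P (X : set V) := (forall a x y, X x -> X y -> X (a *: x + y)) /\
  (forall x, X x -> Z x -> x = 0).
have [C [[Clin CZ] Cmax]] : exists C, P C /\ forall B, (C `<` B)%classic ->
  ~ P B.
  apply: Zorn_bigcup => Fam FP tot; split=>
    [a x y [X FX Xx] [Y FY Yy]|x [X FX Xx]].
    case: (tot _ _ FX FY) => XY.
      by exists Y => //; apply: (FP _ FY).1 => //; exact: XY.
    by exists X => //; apply: (FP _ FX).1 => //; exact: XY.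
  exact: (FP _ FX).2.
have C0 : C 0.
  have [[c Cc]|nC] := pselect (exists c, C c).
    by have := Clin (-1) c c Cc Cc; rewrite scaleN1r addNr.
  case: (Cmax [set 0]%classic).
    split=> [c Cc|h]; last by case: nC; exists 0; exact: h.
    by case: nC; exists c.
  split=> [a x y -> ->|x -> //]; by rewrite scaler0 addr0.
exists C; split=> // x; apply: contrapT => nx.
case: (Cmax [set y | exists2 c, C c & exists a, y = a *: x + c]%classic).
  split=> [c Cc|h]; first by exists c => //; exists 0; rewrite scale0r add0r.
  case: nx; exists x; last by rewrite subrr.
  by apply: h; exists 0 => //; exists 1; rewrite scale1r addr0.
split=> [a y z [c Cc [b ->]] [c' Cc' [b' ->]]|y [c Cc [a ->]] Zy].
  exists (a *: c + c'); first exact: Clin.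
  by exists (a * b + b'); rewrite scalerDr scalerA scalerDl addrACA.
have [a0|na] := eqVneq a 0.
  by move: Zy; rewrite a0 scale0r add0r => /(CZ _ Cc).
case: nx; exists (- a^-1 *: c).
  by rewrite -[X in C X]addr0; exact: Clin.
have := Zlin a^-1 _ 0 Zy Z0.
by rewrite addr0 scalerDr scalerA mulVf // scale1r scaleNr opprK.
Qed.

Variables (N : int -> lmodType K) (dd : forall e e1, N e -> N e1).
Hypothesis dd_lin : forall e e1, linear (@dd e e1).
Hypothesis dd2 : forall e0 e e1 (x : N e0), e = e0 + 1 -> e1 = e + 1 ->
  dd e1 (dd e x) = 0.
Hypothesis acyclic : forall e (x : N e), dd (e + 1) x = 0 ->
  exists y : N (e - 1), dd e y = x.

(** Let C be a complement of the cocycles in each degree.  By acyclicity every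
    x is uniquely d c + c' with c and c' in C, and eta x = c.  Uniqueness gives
    linearity, and eta eta = 0 as elements of C have no coboundary part.  The
    maps are indexed by both degrees, source and target, which avoids transport
    along equalities of degrees. *)
Theorem acyclic_contraction : exists eta : forall e1 e, N e1 -> N e,
  [/\ forall e1 e, linear (@eta e1 e),
      forall e0 e e1 x, e = e0 + 1 -> e1 = e + 1 ->
        eta e e0 (eta e1 e x) = 0 &
      forall e0 e e1 x, e = e0 + 1 -> e1 = e + 1 ->
        dd e (eta e e0 x) + eta e1 e (dd e1 x) = x].
Proof.
have Hker e := @subspace_complement (N e) (fun x => dd (e + 1) x = 0)
  (lin0 (@dd_lin e (e + 1)))
  (fun a x y hx hy => etrans (dd_lin (e + 1) a x y)
     (etrans (f_equal2 (fun u v => a *: u + v) hx hy)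
        (etrans (addr0 _) (scaler0 _ _)))).
pose C e := projT1 (cid (Hker e)).
have C0 e : C e 0 by rewrite /C; case: (cid _) => ? [].
have Clin e a x y : C e x -> C e y -> C e (a *: x + y).
  by rewrite /C; case: (cid _) => ? [h1 h2 h3 h4]; exact: h2.
have CZ e x : C e x -> dd (e + 1) x = 0 -> x = 0.
  by rewrite /C; case: (cid _) => ? [h1 h2 h3 h4]; exact: h3.
have Cdec e x : exists2 c, C e c & dd (e + 1) (x - c) = 0.
  by rewrite /C; case: (cid _) => ? [].
have CB e x y : C e x -> C e y -> C e (x - y).
  by move=> Cx Cy; rewrite addrC -scaleN1r; exact: Clin.
have uniq_eta e1 e (x : N e1) c c' : e1 = e + 1 ->
    C e c -> C e1 (x - dd e1 c) -> C e c' -> C e1 (x - dd e1 c') -> c = c'.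
  move=> E Cc Cx Cc' Cx'; apply/eqP; rewrite -subr_eq0; apply/eqP.
  apply: (CZ _ _); first exact: CB.
  rewrite -E; apply: (CZ _ _); last exact: (dd2 _ E erefl).
  rewrite (linB _ _ (dd_lin _)); have := CB _ _ _ Cx' Cx.
  by rewrite opprB addrC addrA subrK.
have ex_eta e1 e : exists eta : N e1 -> N e, linear eta /\
    (e1 = e + 1 -> forall x, C e (eta x) /\ C e1 (x - dd e1 (eta x))).
  have [E|nE] := pselect (e1 = e + 1); last first.
    by exists (fun _ => 0); split=> // a x y; rewrite scaler0 addr0.
  have [eta heta] : exists eta : N e1 -> N e,
      forall x, C e (eta x) /\ C e1 (x - dd e1 (eta x)).
    have : forall x, exists c, C e c /\ C e1 (x - dd e1 c); last first.
      by move/boolp.choice => [eta heta]; exists eta.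
    move=> x.
    have [c Cc hc] := Cdec e1 x.
    have [y hy] := acyclic hc.
    have Ee : e = e1 - 1 by rewrite E addrK.
    subst e; have [k Ck hk] := Cdec _ y.
    exists k; split=> //; rewrite -[dd e1 k]addr0 opprD.
    have -> : dd e1 k = x - c.
      rewrite -hy; apply/eqP; rewrite eq_sym -subr_eq0 -(linB _ _ (dd_lin _)).
      by move: hk; rewrite -E => ->.
    by rewrite subr0 opprB addrC subrK.
  exists eta; split=> // a x y.
  have [Cx Cx'] := heta x; have [Cy Cy'] := heta y.
  have [Cz Cz'] := heta (a *: x + y).
  apply: (uniq_eta _ _ (a *: x + y)) => //; first exact: Clin.
  rewrite dd_lin opprD addrACA -scalerBr; exact: Clin.
pose eta e1 e := projT1 (cid (ex_eta e1 e)).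
have eta_lin e1 e : linear (eta e1 e) by rewrite /eta; case: (cid _) => ? [].
have etaP e1 e x : e1 = e + 1 -> C e (eta e1 e x) /\ C e1
  (x - dd e1 (eta e1 e x)).
  by rewrite /eta; case: (cid _) => ? [? h] E; exact: h.
exists eta; split=> // e0 e e1 x E E1.
  apply: (uniq_eta e e0 (eta e1 e x)) => //; try exact: (etaP _ _ _ E).1;
    try exact: (etaP _ _ _ E).2.
  by rewrite (lin0 (@dd_lin _ _)) subr0; exact: (etaP _ _ _ E1).1.
rewrite (uniq_eta e1 e (dd e1 x) (eta e1 e (dd e1 x))
  (x - dd e (eta e e0 x))) //.
- by rewrite addrC subrK.
- exact: (etaP _ _ _ E1).1.
- exact: (etaP _ _ _ E1).2.
- exact: (etaP _ _ _ E).2.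
rewrite (linB _ _ (dd_lin _)) (dd2 _ E E1) subr0 subrr; exact: C0.
Qed.

End Contraction.

(** * Sections of strict projections with contractible kernel *)

Section FixedPoint.
Variables (K : fieldType) (V V' : int -> lmodType K) (p : int).

Definition agree_below (f g : mmaps V V' p) n :=
  forall e u, (size u < n)%N -> f e u = g e u.

Lemma zero_mm_lin e : multilinear (fun _ : seq (letter V) => 0 : V' e).
Proof. exact: multilinear0. Qed.

Definition zero_mm : mmaps V V' p :=
  MMaps zero_mm_lin (fun _ _ _ => erefl) (fun _ => erefl).

(** Iterates of [Phi] are stable on words shorter than the number of iterations;
    the fixed point is read off the diagonal. *)
Lemma mmaps_fixpoint (Phi : mmaps V V' p -> mmaps V V' p) :
  (forall f g w, agree_below f g (size w) -> forall e, Phi f e w = Phi g e w) ->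
  exists S : mmaps V V' p, forall e w, S e w = Phi S e w.
Proof.
move=> hPhi; pose it n := iter n Phi zero_mm.
have stab n n' e w : (size w < n)%N -> (size w < n')%N -> it n e w = it n' e w.
  elim: n n' e w => [|n IH] [|n'] e w //= h1 h2.
  by apply: hPhi => e' u lu; apply: IH; apply: leq_trans lu _.
have lin e : multilinear (fun w => it (size w).+1 e w).
  move=> d s1 s2 a x y; rewrite (size_slot _ _ (homog (a *: x + y)) (homog x)).
  by rewrite (size_slot _ _ (homog y) (homog x)) mm_lin.
have deg e w : e != wdeg w + p -> it (size w).+1 e w = 0 by exact: mm_deg.
have nil e : it (size ([::] : seq (letter V))).+1 e [::] = 0 by exact: mm_nil.
exists (MMaps lin deg nil) => e w; rewrite [LHS]/=; apply: hPhi => e' u lu.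
exact: stab.
Qed.

End FixedPoint.

Section Identity.
Variables (K : fieldType) (V : int -> lmodType K).

Lemma id_mm_deg e (w : seq (letter V)) : e != wdeg w + 0 -> wcomp e w = 0.
Proof. by rewrite addr0; exact: wcomp_deg. Qed.

Definition id_mm : mmaps V V 0 :=
  MMaps (@wcomp_multilinear _ V) id_mm_deg (fun _ => erefl).

Lemma coalg_pull_id (W : lmodType K) (phi : seq (letter V) -> W) w :
  multilinear phi -> coalg_pull id_mm phi w = phi w.
Proof.
elim: w phi => [|a w IH] phi h; first by rewrite coalg_pull_nil.
rewrite coalg_pull_cons; transitivity
  (cutsum (fun x z => if x is [::] then phi (a :: z) else 0) w); last first.
  case: w {IH} => //= b w; rewrite -[RHS]addr0 -[in RHS](cutsum0 _ w).
  by congr (_ + _); apply: cutsum_ext.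
apply: cutsum_ext => [[|b x]] z Ew; last first.
  rewrite /mm_app /= (coalg_pull_ext _ (psi := fun _ => 0)) ?coalg_pull0 // =>
    u _.
  exact: (multilinear_zero [::] _ _ h).
rewrite -[z]cat0s Ew IH; last exact: multilinear_cons.
rewrite /mm_app /= /wdeg big_seq1 addr0; case: a => d x.
by rewrite -/(homog x) lcomp_homog.
Qed.

End Identity.

Section StrictFibration.
Variables (K : fieldType) (B D : ainf_algebra K).
Local Notation mB := (ainf_ops B).
Local Notation mD := (ainf_ops D).
Variables (p : forall d, D d -> B d) (s0 : forall d, B d -> D d).
Variable eta : forall e1 e, D e1 -> D e.
Hypotheses (p_lin : forall d, linear (@p d))
  (s0_lin : forall d, linear (@s0 d)).
Hypothesis eta_lin : forall e1 e, linear (@eta e1 e).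
Hypothesis p_strict : forall e w, p (mD e w) = mB e (map (lmap p) w).
Hypothesis p_s0 : forall d (x : B d), p (s0 x) = x.
Hypothesis p_eta : forall e1 e (x : D e1), p (eta e x) = 0.
Hypothesis eta_s0 : forall e1 e (x : B e1), eta e (s0 x) = 0.
Hypothesis eta_eta : forall e0 e e1 (x : D e1), e = e0 + 1 -> e1 = e + 1 ->
  eta e0 (eta e x) = 0.
Hypothesis eta_contr : forall e0 e e1 (x : D e), e = e0 + 1 -> e1 = e + 1 ->
  p x = 0 ->
  mD e [:: homog (eta e0 x)] + eta e (mD e1 [:: homog x]) = x.

(** The operations m_k with k at least 2. *)
Definition higher e (w : seq (letter D)) : D e :=
  if (size w <= 1)%N then 0 else mD e w.

Lemma higher_lin e : multilinear (higher e).
Proof.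
move=> d s1 s2 a x y; rewrite /higher.
rewrite (size_slot _ _ (homog (a *: x + y)) (homog x)).
rewrite (size_slot _ _ (homog y) (homog x)).
by case: ifP => _; rewrite ?mm_lin // scaler0 addr0.
Qed.

(** The right-hand side of s = sigma - eta (m_1 sigma + m_2 (S) + ...). *)
Definition section_step (S : mmaps B D 0) e w : D e :=
  s0 (wcomp e w) - eta e (mD (e + 1) [:: homog (s0 (wcomp e w))] +
                          coalg_pull S (higher (e + 1)) w).

Lemma step_lin S e : multilinear (section_step S e).
Proof.
apply: multilinearD.
  exact: (multilinear_comp (@s0_lin e) (@wcomp_multilinear _ _ e)).
apply: multilinearN; apply: (multilinear_comp (@eta_lin _ _)).
apply: multilinearD; last exact/multilinear_coalg_pull/higher_lin.
apply: (multilinear_comp (L := fun x => mD (e + 1) [:: homog (s0 x)])).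
  by move=> a x y; rewrite s0_lin mm_letterD.
exact: wcomp_multilinear.
Qed.

Lemma step_deg S e w : e != wdeg w + 0 -> section_step S e w = 0.
Proof.
rewrite addr0 => ne; rewrite /section_step wcomp_deg // (lin0 (@s0_lin _)).
rewrite mm_letter0 (coalg_pull_ext S (psi := fun _ => 0)) ?coalg_pull0 ?addr0.
  by rewrite (lin0 (@eta_lin _ _)) subrr.
move=> u Eu; rewrite /higher; case: ifP => // _; apply: mm_deg.
by rewrite Eu (inj_eq (addIr 1)).
Qed.

Lemma step_nil S e : section_step S e [::] = 0.
Proof.
rewrite /section_step /= (lin0 (@s0_lin _)) mm_letter0 coalg_pull_nil addr0.
by rewrite (lin0 (@eta_lin _ _)) subrr.
Qed.

Definition step_mm S : mmaps B D 0 := MMaps (step_lin S) (@step_deg S)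
    (step_nil S).

Section Fixed.
Variable S : mmaps B D 0.
Hypothesis S_fix : forall e w, S e w = section_step S e w.
Local Notation E := (defect S mB mD).

Lemma p_S e w : p (S e w) = wcomp e w.
Proof.
by rewrite S_fix (linB _ _ (@p_lin _)) p_s0 p_eta subr0.
Qed.

(** The gauge condition that makes the equation for [S] equivalent to
    eta m S = 0. *)
Lemma eta_S e e0 w : e = e0 + 1 -> eta e0 (S e w) = 0.
Proof.
by move=> De; rewrite S_fix (linB _ _ (@eta_lin _ _)) eta_s0 eta_eta ?subr0.
Qed.

Lemma p_defect e w : p (E e w) = 0.
Proof.
rewrite /defect (linB _ _ (@p_lin _)) (coalg_pull_lin _ _ _ (@p_lin _)).
rewrite (coder_pull_lin _ _ _ (@p_lin _))
  (coalg_pull_ext _ (fun u _ => p_strict e u)).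
rewrite (coalg_pull_lmap (g := id_mm B) (mB e) w p_S) coalg_pull_id;
  last exact: mm_lin.
by rewrite (coder_pull_ext _ (fun u _ => p_S e u)) coder_pull_wcomp subrr.
Qed.

Lemma coalg_pull_mD e w :
  coalg_pull S (mD e) w = mD e [:: mm_app S w] + coalg_pull S (higher e) w.
Proof.
rewrite (coalg_pull_ext S (psi := fun u =>
  (if size u == 1%N then mD e u else 0) + higher e u)); last first.
  move=> [|a [|b u]] _; rewrite /higher /= ?addr0 ?add0r ?mm_nil //.
rewrite coalg_pullD coalg_pull_single => [|u /negbTE -> //].
by case: w => //=; rewrite /mm_app mm_nil mm_letter0.
Qed.

(** By [eta_S] this is eta m S = 0.  As S - sigma = - eta Q lies in the kernel
    of the projection and is killed by eta, the contraction gives eta m_1 (S -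
    sigma) = S - sigma, and the equation for [S] concludes. *)
Lemma eta_defect e e0 w : e = e0 + 1 -> eta e0 (E e w) = 0.
Proof.
move=> De; have [Ee|ne] := eqVneq e (wdeg w + 1); last first.
  by rewrite defect_deg // (lin0 (@eta_lin _ _)).
have Ee0 : e0 = wdeg w by apply: (addIr 1); rewrite -De.
rewrite /defect (linB _ _ (@eta_lin _ _)) (coder_pull_lin _ _ _ (@eta_lin _ _)).
rewrite (coder_pull_ext _ (psi := fun _ => 0)) ?coder_pull0 ?subr0; last first.
  by move=> u _; exact: eta_S.
rewrite coalg_pull_mD (@mm_app_homog _ _ _ _ _ _ e0) ?addr0 //.
set Q := mD e [:: homog (s0 (wcomp e0 w))] + coalg_pull S (higher e) w.
have ES : S e0 w = s0 (wcomp e0 w) - eta e0 Q.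
  by rewrite S_fix /section_step /Q De.
rewrite ES mm_letterB addrAC -/Q (linB _ _ (@eta_lin _ _)).
have := @eta_contr (e0 - 1) e0 e (eta e0 Q).
rewrite subrK p_eta eta_eta ?subrK // mm_letter0 add0r => -> //.
by rewrite subrr.
Qed.

(** On the kernel, E = m_1 eta E + eta m_1 E = eta m_1 E.  If E vanishes on
    shorter words, [defect_pull] at phi = m identifies m_1 E with the pullback
    of - m S along m, that is of - E - S m; the square of m disappears and eta
    E = 0. *)
Lemma section_defect e w : E e w = 0.
Proof.
have [n] := ubnP (size w); elim: n w e => // n IH w e lt.
have [Ee|ne] := eqVneq e (wdeg w + 1); last exact: defect_deg.
rewrite -(@eta_contr (wdeg w) e (e + 1) (E e w)) ?p_defect // eta_defect //.
rewrite mm_letter0 add0r.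
have : coalg_pull S (coder_pull mD (mD (e + 1))) w - coder_pull mB
  (coalg_pull S (mD (e + 1))) w =
       mD (e + 1) [:: homog (E (wdeg w + 1) w)].
  apply: defect_pull; first exact: mm_lin.
  by move=> u lu e'; apply: IH; apply: leq_trans lu _.
rewrite -Ee => <-; rewrite (coalg_pull_ext _ (fun u _ => ainf_square _ u))
  coalg_pull0 sub0r.
rewrite (linN _ (@eta_lin _ _)).
rewrite (coder_pull_ext _ (psi := fun u => E (e + 1) u + coder_pull mB
  (S (e + 1)) u)).
  rewrite coder_pullD coder_pull_square ?addr0;
    [|exact: ainf_square|exact: mm_lin].
  rewrite (coder_pull_lin _ _ _ (@eta_lin _ _))
    (coder_pull_ext _ (psi := fun _ => 0)).
    by rewrite coder_pull0 oppr0.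
  by move=> u _; exact: eta_defect.
by move=> u _; rewrite /defect subrK.
Qed.

End Fixed.

Theorem strict_fibration_section :
  exists S : ainf_morphism B D, forall e w, p (S e w) = wcomp e w.
Proof.
have [|S S_fix] := @mmaps_fixpoint K B D 0 step_mm.
  move=> f g w fg e; rewrite /= /section_step (coalg_pull_congr_lt (g := g)) //.
have S_morph := proj2 (coalg_mapP mB mD S) (section_defect S_fix).
by exists (AinfMorphism S_morph); exact: p_S.
Qed.

End StrictFibration.

(** * The mapping cone and the inverse *)

Section QuasiInverse.
Variables (K : fieldType) (A B : ainf_algebra K) (F : ainf_morphism A B).
Hypothesis F_quasi : quasi_isomorphism F.
Local Notation mA := (ainf_ops A).
Local Notation mB := (ainf_ops B).

Lemma coh_class_eqP (C : ainf_algebra K) d (x y : cocycle C d) :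
  coh_class x = coh_class y <->
  exists z : C (d - 1), val x - val y = ainf_ops C d [:: homog z].
Proof.
split=> [/(@eqmodP _ (cohomologous_equiv C d))/asboolP //|h].
exact/(@eqmodP _ (cohomologous_equiv C d))/asboolP.
Qed.

Lemma coh_reprK (C : ainf_algebra K) d (c : cohomology C d) :
  coh_class (coh_repr c) = c.
Proof. exact: reprK. Qed.

(** Injectivity of F on cohomology, in terms of representatives. *)
Lemma coh_inj d (a : A d) (b : B (d - 1)) :
  mA (d + 1) [:: homog a] = 0 -> F d [:: homog a] = mB d [:: homog b] ->
  exists a' : A (d - 1), mA d [:: homog a'] = a.
Proof.
move=> /eqP ca Fa; pose x : cocycle A d := exist _ a ca.
have c0 : is_cocycle (0 : A d) by rewrite /is_cocycle mm_letter0.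
pose x0 : cocycle A d := exist _ 0 c0.
have E : coh_class x = coh_class x0.
  apply: (bij_inj (F_quasi d)); rewrite !coh_mapE; apply/coh_class_eqP.
  by exists b; rewrite /= mm_letter0 subr0.
have [z hz] := proj1 (coh_class_eqP x x0) E.
by exists z; rewrite -hz /= subr0.
Qed.

(** Surjectivity of F on cohomology, in terms of representatives. *)
Lemma coh_surj d (b : B d) : mB (d + 1) [:: homog b] = 0 ->
  exists a : A d, mA (d + 1) [:: homog a] = 0 /\
    exists b' : B (d - 1), b - F d [:: homog a] = mB d [:: homog b'].
Proof.
move=> /eqP cb; pose y : cocycle B d := exist _ b cb.
have [G _ FG] := F_quasi d.
have := FG (coh_class y); rewrite -[G _]coh_reprK coh_mapE.
set x := coh_repr _ => /esym/coh_class_eqP[z hz].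
by exists (val x); split; [exact/eqP/(valP x) | exists z].
Qed.

(** The kernel of the projection of [path_algebra] to B, with its differential:
    the mapping cone of the linear part of F. *)
Definition cone (d : int) : lmodType K := (A d * B (d - 1))%type.

Definition cone_diff e e1 (x : cone e) : cone e1 :=
  (mA e1 [:: homog x.1],
   F (e1 - 1) [:: homog x.1] - mB (e1 - 1) [:: homog x.2]).

Lemma F_morph e w : defect F mA mB e w = 0.
Proof. by move: e w; apply/coalg_mapP; exact: ainf_mapsP. Qed.

Lemma cone_diff_lin e e1 : linear (@cone_diff e e1).
Proof.
move=> a x y; rewrite /cone_diff /= !mm_letterD.
by rewrite opprD addrACA -scalerBr.
Qed.

Lemma cone_diff2 e0 e e1 (x : cone e0) : e = e0 + 1 -> e1 = e + 1 ->
  cone_diff e1 (cone_diff e x) = 0.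
Proof.
move=> E E1; rewrite /cone_diff /= mm_letterB.
have hA e' : mA e' [:: homog (mA e [:: homog x.1])] = 0.
  by rewrite -(@mm_app_homog _ _ _ _ mA _ e) ?ops_square // wdeg1.
have hB e' : mB e' [:: homog (mB (e - 1) [:: homog x.2])] = 0.
  by rewrite -(@mm_app_homog _ _ _ _ mB _ (e - 1)) ?ops_square // wdeg1 subrK E
    addrK.
have hF e' : F e' [:: homog (mA e [:: homog x.1])] =
             mB e' [:: homog (F (e - 1) [:: homog x.1])].
  rewrite -(@mm_app_homog _ _ _ _ mA _ e) ?wdeg1 //.
  rewrite (defect_letter (F_morph _ _)) (@mm_app_homog _ _ _ _ F _ (e - 1)) //.
  by rewrite wdeg1 E addrK addr0.
by rewrite hA hB hF subr0 subrr.
Qed.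

Lemma cone_acyclic e (x : cone e) : cone_diff (e + 1) x = 0 ->
  exists y : cone (e - 1), cone_diff e y = x.
Proof.
case: x => a b; rewrite /cone_diff /= => -[ha /eqP].
rewrite subr_eq0 addrK => /eqP hb.
have [a' ha'] := coh_inj ha hb.
have hF : F e [:: homog a] = mB e [:: homog (F (e - 1) [:: homog a'])].
  by rewrite -ha'; apply: morphism1; rewrite subrK.
have [|a'' [ca'' [b' hb']]] := @coh_surj (e - 1) (b - F (e - 1) [:: homog a']).
  by rewrite mm_letterB subrK -hb hF subrr.
exists (1 *: a' + a'', - b') => /=; rewrite !mm_letterD !scale1r ha'.
rewrite subrK in ca''; rewrite ca'' addr0; congr (_, _).
rewrite -[- b']sub0r mm_letterB mm_letter0 sub0r opprK -hb'.
by rewrite -[b - _ - _]addrA -opprD [LHS]addrC subrK.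
Qed.

Local Notation D := (path_algebra F_morph).
Local Notation mD := (ainf_ops D).
Local Notation pr := (@path_right K A B).

Definition path_const d (b : B d) : D d := (0, b, 0).

Lemma path_const_lin d : linear (@path_const d).
Proof.
by move=> a x y; rewrite /path_const; congr (_, _, _);
  exact: esym (etrans (addr0 _) (scaler0 _ _)).
Qed.

Lemma path_mm_cone e e1 (x : D e) : pr x = 0 ->
  mD e1 [:: homog x] =
  ((cone_diff e1 (x.1.1, x.2)).1, 0, (cone_diff e1 (x.1.1, x.2)).2).
Proof.
case: x => [[a b] s] /= hx; rewrite /= /path_mm; congr (_, _, _).
  by rewrite /= /lmap hx mm_letter0.
rewrite /path_op /= /lmap hx wsign_nil scale1r scaler0 addr0.
rewrite [lcomp _ _](_ : _ = 0) ?subr0; last exact: (mm_letter0 (id_mm B)).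
by rewrite /coalg_pull_pre coalg_pull_nil.
Qed.

Lemma path_section : exists S : ainf_morphism B D, forall e w,
  pr (S e w) = wcomp e w.
Proof.
have [eta [eta_lin eta2 eta_contr]] :=
  acyclic_contraction cone_diff_lin cone_diff2 cone_acyclic.
pose heta e1 e (x : D e1) : D e :=
  ((eta e1 e (x.1.1, x.2)).1, 0, (eta e1 e (x.1.1, x.2)).2).
apply: (@strict_fibration_section K B D pr path_const heta).
- by [].
- exact: path_const_lin.
- move=> e1 e a x y; rewrite /heta.
  have := eta_lin e1 e a (x.1.1, x.2) (y.1.1, y.2).
  rewrite -[a *: (_, _) + _]/((a *: x + y).1.1, (a *: x + y).2) => ->.
  by congr (_, _, _); exact: esym (etrans (addr0 _) (scaler0 _ _)).
- by [].
- by [].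
- by [].
- move=> e1 e x; rewrite /heta /=.
  by have := lin0 (eta_lin e1 e); rewrite -[0]/(0, 0) => ->.
- move=> e0 e e1 x E E1; rewrite /heta /= -surjective_pairing.
  by rewrite eta2.
move=> e0 e e1 x E E1 px.
rewrite !path_mm_cone // /heta /=.
have := eta_contr e0 e e1 (x.1.1, x.2) E E1.
case: x px => [[a b] s] /= hx; rewrite /path_right /= in hx; rewrite hx.
move=> H; have H1 := congr1 fst H; have H2 := congr1 snd H.
congr (_, _, _); [exact: H1 | exact: addr0 | exact: H2].
Qed.

(** The third component of the morphism equation of the section, on a cocycle
    b, reads f g b - b = m h; so g is a right inverse of the bijection that f
    induces on cohomology. *)
Theorem quasi_inverse :
  exists G : ainf_morphism B A, inverse_quasi_isomorphism F G.
Proof.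
have [S pBS] := path_section.
have S_morph e w : defect S mB mD e w = 0.
  by move: e w; apply/coalg_mapP; exact: ainf_mapsP.
have lin e : multilinear (fun w => path_left (S e w)).
  by apply: (multilinear_comp (@path_left_linear K A B e)); exact: mm_lin.
have deg e w : e != wdeg w + 0 -> path_left (S e w) = 0 by move=> ne;
  rewrite mm_deg.
have nil e : path_left (S e [::]) = 0 by rewrite mm_nil.
pose g : mmaps B A 0 := MMaps lin deg nil.
have g_morph e w : defect g mB mA e w = 0.
  rewrite /defect -(coalg_pull_lmap (L := @path_left K A B) (f := S) (g := g)
    (mA e) w) //.
  have -> : 0 = path_left (defect S mB mD e w) by rewrite S_morph.
  rewrite /defect (linB _ _ (@path_left_linear K A B e)).
  by rewrite (coalg_pull_lin _ _ _ (@path_left_linear K A B e))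
    (coder_pull_lin _ _ _ (@path_left_linear K A B e)).
pose G := AinfMorphism (proj2 (coalg_mapP mB mA g) g_morph).
have FG d : cancel (coh_map G (d := d)) (coh_map F (d := d)).
  move=> c; rewrite -[c]coh_reprK !coh_mapE; apply/coh_class_eqP.
  case: (coh_repr c) => b cb /=.
  exists (path_htpy (S d [:: homog b])).
  have Sb : path_op F d [:: homog (S d [:: homog b])] = 0.
    have := defect_letter (S_morph (d + 1) [:: homog b]).
    rewrite (@mm_app_homog _ _ _ _ mB _ (d + 1)) ?wdeg1 // (eqP cb) mm_letter0.
    rewrite (@mm_app_homog _ _ _ _ S _ d) ?wdeg1 ?addr0 //.
    by move/(congr1 (fun x : D (d + 1) => x.2)); rewrite /= addrK.
  move: Sb; rewrite /path_op /= scaler0 addr0 wsign_nil scale1r.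
  rewrite /coalg_pull_pre coalg_pull_nil /= lcomp_homog.
  rewrite [path_right _](_ : _ = b); first by move/eqP;
    rewrite subr_eq0 => /eqP.
  by rewrite pBS /= lcomp_homog.
have GF d : cancel (coh_map F (d := d)) (coh_map G (d := d)).
  by move=> c; apply: (bij_inj (F_quasi d)); rewrite FG.
exists G; split=> d; last by split.
by exists (coh_map F (d := d)).
Qed.

End QuasiInverse.

Local Open Scope complex_scope.

Theorem theorem5p17 (R : realType) (A B : ainf_algebra R[i])
    (F : ainf_morphism A B) (hF : quasi_isomorphism F) :
  exists G : ainf_morphism B A, inverse_quasi_isomorphism F G.
Proof. exact: quasi_inverse hF. Qed.
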